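(* Let $f\colon X\to[-\infty,+\infty]$ be a densely defined lower semicontinuous functional, and let $(y_t)_{t\in(0,T)}$ be an $\mathrm{EVI}_{K,N}$ gradient curve for $f$, for some $K\in\mathbb R$ and $N<0$. Then $(y_t)_{t\in(0,T)}$ is a curve of maximal slope for $f$ and satisfies the Energy Dissipation Equality (EDE). In particular, it satisfies the Energy Dissipation Inequality (EDI).
   Context: Setting. $(X,d)$ is a metric space, not necessarily complete, which is strictly intrinsic (any two points are joined by a geodesic in $X$) and whose metric completion is geodesic (complete and strictly intrinsic). A geodesic is a continuous curve $\gamma\colon[0,1]\to X$ with $d(\gamma_s,\gamma_t)=|t-s|\,d(\gamma_0,\gamma_1)$. $\mathcal D[f]=\{f\ne\pm\infty\}\neq\emptyset$, $\mathcal D^\star[f]=\{f<+\infty\}$; ''densely defined'' means that $\mathcal D[f]$ is dense in $X$. For $N<0$, $f_N:=e^{-f/N}$, with $f_N=0$ where $f=-\infty$ and $f_N=+\infty$ where $f=+\infty$. $\frac{\mathrm d^+}{\mathrm dt}h(t):=\limsup_{\epsilon\downarrow0}\frac{h(t+\epsilon)-h(t)}{\epsilon}$. For $\theta\ge0$: $\mathfrak s_{K,N}(\theta)=\frac{\sin(\theta\sqrt{K/N})}{\sqrt{K/N}}$ if $K<0$, $=\theta$ if $K=0$, $=\frac{\sinh(\theta\sqrt{-K/N})}{\sqrt{-K/N}}$ if $K>0$. $\mathrm{EVI}_{K,N}$ gradient curve for $f$: a continuous curve $(y_t)_{t\in(0,T)}\subset\mathcal D[f]$, $T\in(0,+\infty]$,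 such that $$\frac{\mathrm d^+}{\mathrm dt}\Big[\mathfrak s_{K,N}\big(\tfrac{d(y_t,z)}2\big)^2\Big]+K\,\mathfrak s_{K,N}\big(\tfrac{d(y_t,z)}2\big)^2\le\frac N2\Big(1-\frac{f_N(z)}{f_N(y_t)}\Big)$$ for every $z\in\mathcal D^\star[f]$ and every $t\in(0,T)$, with $d(y_t,z)<\pi\sqrt{N/K}$ if $K<0$. $AC^p_{\mathrm{loc}}((0,T),X)$ denotes the curves $y$ for which there is $m\in L^p_{\mathrm{loc}}(0,T)$ with $d(y_s,y_t)\le\int_s^tm\,\mathrm dr$ for $s<t$; $|\dot y_t|=\lim_{h\to0}d(y_{t+h},y_t)/|h|$ is the metric derivative. Descending slope at $y\in\mathcal D[f]$: $|D^-f|(y)=\limsup_{z\to y}\frac{(f(z)-f(y))^-}{d(z,y)}$, where $a^-=\max\{-a,0\}$. Curve of maximal slope for $f$: a curve $(y_t)_{t\in(0,T)}\subset\mathcal D[f]$ such that (a) $y\in AC^1_{\mathrm{loc}}((0,T),X)$; (b) $t\mapsto f(y_t)$ is in $AC^1_{\mathrm{loc}}((0,T),\mathbb R)$; (c) $-\frac{\mathrm d}{\mathrm dt}f(y_t)\ge\frac12|\dot y_t|^2+\frac12|D^-f|^2(y_t)$ for a.e. $t\in(0,T)$. (EDE): $f(y_t)=\lim_{\epsilon\downarrow0}f(y_\epsilon)-\int_0^t\big[\frac12|\dot y_s|^2+\frac12|D^-f|^2(y_s)\big]\mathrm ds$ for every $0<t<T$. When $\lim_{\epsilon\downarrow0}f(y_\epsilon)=+\infty$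 this is understood as $f(y_\epsilon)-f(y_t)=\int_\epsilon^t[\dots]\,\mathrm ds$ for all $0<\epsilon<t<T$. (EDI): $y\in AC^2_{\mathrm{loc}}((0,T),X)$ and $f(y_t)\le\lim_{\epsilon\downarrow0}f(y_\epsilon)-\int_0^t\big[\frac12|\dot y_s|^2+\frac12|D^-f|^2(y_s)\big]\mathrm ds$ for every $t\in(0,T)$, with the analogous reading when the limit is $+\infty$. *)

(* Defs.v *)
From HB Require Import structures.
From mathcomp Require Import all_boot all_order all_algebra.
From mathcomp Require Import all_classical all_reals all_analysis.

Set Implicit Arguments.
Unset Strict Implicit.
Unset Printing Implicit Defensive.

Import Order.TTheory GRing.Theory Num.Theory.
Import numFieldNormedType.Exports.

Local Open Scope classical_set_scope.
Local Open Scope ring_scope.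

(* Curves on (0, T) are total functions on R; only their values on the open
   interval [timespan T] are ever constrained or used. *)
Definition timespan (R : realType) (T : \bar R) : set R :=
  [set t | 0 < t /\ (t%:E < T)%E].

Section metric_spaces.
Context {R : realType}.
Implicit Types X Y : metricType R.

Definition is_geodesic X (g : R -> X) : Prop :=
  {within `[0, 1], continuous g} /\
  forall s t : R, 0 <= s <= 1 -> 0 <= t <= 1 ->
    mdist (g s) (g t) = `|t - s| * mdist (g 0) (g 1).

Definition strictly_intrinsic X : Prop :=
  forall x y : X, exists g : R -> X, [/\ is_geodesic g, g 0 = x & g 1 = y].

Definition complete_space X : Prop :=
  forall F : set_system X, ProperFilter F -> cauchy F -> exists x : X, F --> x.

Definition is_metric_completion X Y (i : X -> Y) : Prop :=
  [/\ complete_space Y,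
      forall x x' : X, mdist (i x) (i x') = mdist x x'
    & dense (range i)].

Definition has_geodesic_completion X : Prop :=
  exists (Y : metricType R) (i : X -> Y),
    is_metric_completion i /\ strictly_intrinsic Y.

End metric_spaces.

Section functionals.
Context {R : realType} {X : metricType R}.
Implicit Types (f : X -> \bar R) (x : X).

Definition fdom f : set X := [set x | f x \is a fin_num].

Definition fdom_star f : set X := [set x | (f x < +oo)%E].

Definition densely_defined f : Prop := fdom f !=set0 /\ dense (fdom f).

(* For N < 0 the factor - N^-1 is positive, so [expeR] yields 0 where f = -oo
   and +oo where f = +oo. *)
Definition fexpN (N : R) f x : \bar R := expeR ((- N^-1)%R%:E * f x)%E.

(* The limsup is over z != x. The maximum with 0 only matters at an isolated
   point x, where the limsup over the empty set, taken in [0, +oo], is 0 while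
   [limf_esup], which takes values in \bar R, is -oo. *)
Definition descending_slope f x : \bar R :=
  maxe 0%E
    (limf_esup (fun z : X =>
       maxe (- (f z - f x)) 0 * ((mdist z x)^-1)%R%:E)%E x^').

End functionals.

Section real_functions.
Context {R : realType}.
Implicit Types (K N theta t : R) (h : R -> R).

Definition sinh (x : R) : R := (expR x - expR (- x)) / 2.

Definition sKN K N theta : R :=
  if K < 0 then sin (theta * Num.sqrt (K / N)) / Num.sqrt (K / N)
  else if K == 0 then theta
  else sinh (theta * Num.sqrt (- K / N)) / Num.sqrt (- K / N).

Definition upper_right_derivative h t : \bar R :=
  limf_esup (fun e : R => ((h (t + e) - h t) / e)%:E) 0^'+.

End real_functions.

Section curves.
Context {R : realType} {X : metricType R}.
Implicit Types (f : X -> \bar R) (y : R -> X) (T : \bar R) (K N p t : R).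

(* Both f_N(z) and f_N(y_t) are finite here, since f z < +oo and f (y t) is
   finite, so that [fine] loses nothing. *)
Definition EVI_gradient_curve K N f T y : Prop :=
  [/\ forall t, timespan T t -> fdom f (y t),
      forall t, timespan T t -> {for t, continuous y}
    & forall (z : X) t, fdom_star f z -> timespan T t ->
        (K < 0 -> mdist (y t) z < pi * Num.sqrt (N / K)) ->
        let phi := fun s => sKN K N (mdist (y s) z / 2) ^+ 2 in
        (upper_right_derivative phi t + (K * phi t)%R%:E
         <= (N / 2 * (1 - fine (fexpN N f z) / fine (fexpN N f (y t))))%R%:E)%E].

Definition Lp_loc p T (m : R -> R) : Prop :=
  measurable_fun (timespan T) m /\
  locally_integrable (timespan T) (fun t => `|m t| `^ p).

Definition AC_loc p T y : Prop :=
  exists2 m : R -> R, Lp_loc p T m &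
    forall s t : R, timespan T s -> timespan T t -> s < t ->
      ((mdist (y s) (y t))%:E
       <= \int[lebesgue_measure]_(r in `[s, t]) (m r)%:E)%E.

Definition metric_quotient y t (h : R) : R := mdist (y (t + h)) (y t) / `|h|.

Definition metric_derivable y t : Prop :=
  cvg (metric_quotient y t h @[h --> 0^']).

Definition metric_derivative y t : R :=
  lim (metric_quotient y t h @[h --> 0^']).

Definition dissipation f y t : \bar R :=
  ((2^-1 * metric_derivative y t ^+ 2)%R%:E
   + (2^-1)%R%:E * descending_slope f (y t) ^+ 2)%E.

End curves.

Section gradient_flows.
Context {R : realType} {X : metricType R}.
Implicit Types (f : X -> \bar R) (T : \bar R) (y : R -> X).

Definition maximal_slope_curve f T y : Prop :=
  let fy : R^o -> R^o := fun t => fine (f (y t)) in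
  [/\ forall t, timespan T t -> fdom f (y t),
      AC_loc 1 T y,
      AC_loc 1 T fy
    & {ae lebesgue_measure, forall t : R, timespan T t ->
         [/\ metric_derivable y t, derivable fy t 1
           & (dissipation f y t <= (- derive1 fy t)%R%:E)%E]}].

Local Open Scope ereal_scope.

(* A value l = -oo is ruled out by the last clause, as f (y t) is finite. *)
Definition EDE f T y : Prop :=
  exists2 l : \bar R, f (y e) @[e --> 0%R^'+] --> l &
    if l == +oo then
      forall e t : R, timespan T e -> timespan T t -> (e < t)%R ->
        f (y e) - f (y t) =
        \int[lebesgue_measure]_(s in `]e, t[) dissipation f y s
    else
      forall t : R, timespan T t ->
        f (y t) =
        l - \int[lebesgue_measure]_(s in `]0%R, t[) dissipation f y s.

Definition EDI f T y : Prop :=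
  AC_loc 2 T y /\
  exists2 l : \bar R, f (y e) @[e --> 0%R^'+] --> l &
    if l == +oo then
      forall e t : R, timespan T e -> timespan T t -> (e < t)%R ->
        \int[lebesgue_measure]_(s in `]e, t[) dissipation f y s
        <= f (y e) - f (y t)
    else
      forall t : R, timespan T t ->
        f (y t) <=
        l - \int[lebesgue_measure]_(s in `]0%R, t[) dissipation f y s.

End gradient_flows.

(* Main.v *)
(* Write [g t] for the energy f (y t) and [D s t] for the distance between y s
   and y t. Taking z on the curve itself, a Gronwall argument on the EVI shows
   that [g] is nonincreasing and right-continuous, with
   D s t ^ 2 <= C (t - s) (g s - g t) locally. By Fatou's lemma the difference
   quotients of [g] have a finite lower limit almost everywhere, so at almost
   every t the lower right metric speed is a finite number p.

   At such a point the EVI, with z arbitrary near y t, bounds the descending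
   slope by p. This slope bound fed back into the EVI with z = y t controls the
   growth of D (t + h) t and of the energy loss: the curve has right metric speed
   p and [g] has right derivative - p ^ 2. The same growth bound is locally
   uniform, of the form g t - g (t + h) <= C p ^ 2 h, so dominated convergence
   gives that [g] is the integral of - p ^ 2, and the Lebesgue differentiation
   theorem then makes both derivatives two-sided. Finally the slope is at least
   p because along the curve the energy drops by about p ^ 2 h over a distance
   p h. Hence metric speed and slope agree almost everywhere, and the
   dissipation p ^ 2 / 2 + p ^ 2 / 2 integrates to the loss of energy. *)

Require Import Defs.
From mathcomp Require Import all_boot all_order all_algebra.
From mathcomp Require Import all_classical all_reals all_analysis.
From mathcomp Require Import measurable_realfun.
From mathcomp Require Import ring lra.
Import Order.TTheory GRing.Theory Num.Theory.
Import numFieldNormedType.Exports.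
Local Open Scope ring_scope.
Local Open Scope classical_set_scope.

Set Implicit Arguments.
Unset Strict Implicit.
Unset Printing Implicit Defensive.

(** The functions [f_N] enter only through [excess z t], equal to f z - f (y t) to first order, and
    four times the squared model function is d ^ 2 to first order. Near the diagonal the EVI thus
    reads (d ^ 2)' <= 2 (f z - f (y t)), up to factors close to 1 and a term in [K] that is absorbed
    on short time intervals. The obstacle is regularity: [y] is only continuous, the energy along it
    only lower semicontinuous, and the EVI bounds only right derivatives, so that nothing can be
    said from the left before the energy is known to be an integral. A second obstacle is that the
    slope is not known to be measurable. The speed is therefore encoded as a measurable function
    [max_speed], read off from the energy alone, and the dissipation is replaced by
    [max_speed r ^+ 2] through a comparison of integrals that is valid for nonmeasurable
    functions. *)

Section epsilon_delta.
Context {R : realType}.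
Implicit Types (v : R -> R) (a b c r l k e : R).

Lemma near_right0P (P : R -> Prop) :
  (\forall e \near 0^'+, P e) <->
  exists2 d, 0 < d & forall e, 0 < e < d -> P e.
Proof.
split=> [|[d d0 hd]].
  case/nbhs_ballP => d /= d0 hd; exists d => // e /andP[e0 ed].
  by apply: hd; rewrite // /ball/= sub0r normrN gtr0_norm.
near=> e; apply: hd; apply/andP; split; first by near: e; exact: nbhs_right_gt.
by near: e; exact: nbhs_right_lt.
Unshelve. all: by end_near. Qed.

Lemma continuous_dist v r : {for r, continuous v} ->
  forall eps, 0 < eps ->
    exists2 d, 0 < d & forall x, `|x - r| < d -> `|v x - v r| < eps.
Proof.
move=> /cvgrPdist_lt cv eps /cv /nbhs_ballP[d /= d0 hd]; exists d => // x xr.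
by rewrite distrC; apply: hd; rewrite /ball/= distrC.
Qed.

End epsilon_delta.

(** * Differential inequalities for upper right Dini derivatives *)

Section dini.
Context {R : realType}.
Implicit Types (v : R -> R) (a b c r l k e : R).

(** The upper right Dini derivative of [v] at [r] is at most [l], in a form free of extended reals
    and of division. *)
Definition dini_le v r l : Prop :=
  forall eps, 0 < eps -> exists2 d, 0 < d &
    forall e, 0 < e < d -> v (r + e) - v r <= (l + eps) * e.

Lemma upper_right_derivative_dini v r c l :
  (upper_right_derivative v r + c%:E <= l%:E)%E -> dini_le v r (l - c).
Proof.
move=> h eps eps0; apply/near_right0P.
have : (upper_right_derivative v r < (l - c + eps)%:E)%E.
  rewrite (@le_lt_trans _ _ (l - c)%:E) ?lte_fin ?ltrDl//.
  by rewrite EFinB leeBrDr.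
rewrite /upper_right_derivative /limf_esup => /ereal_inf_lt[_ [V FV <-]] hV.
have e0 : \forall e \near (0 : R)^'+, 0 < e by exact: nbhs_right_gt.
apply: filterS2 FV e0 => e Ve egt0.
have : ((((v (r + e) - v r) / e)%:E <= (l - c + eps)%:E))%E.
  by rewrite (le_trans _ (ltW hV))//; apply: ereal_sup_ubound; exists e.
by rewrite lee_fin ler_pdivrMr.
Qed.

Lemma dini_le_weaken v r l l' : l <= l' -> dini_le v r l -> dini_le v r l'.
Proof.
move=> ll' h eps /h[d d0 hd]; exists d => // e /[dup] ed /hd /le_trans; apply.
by case/andP: ed => e0 _; rewrite ler_pM2r// lerD2r.
Qed.

(* The set of [r] up to which [v] stays below the line is closed by continuity;
   at its supremum [v] touches the line and the Dini bound pushes it below. *)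
Lemma dini_comparison v a b k c : a <= b ->
  (forall r, a <= r <= b -> {for r, continuous v}) -> v a <= k ->
  (forall r, a <= r < b -> v r = k + c * (r - a) ->
     exists2 l, l < c & dini_le v r l) ->
  v b <= k + c * (b - a).
Proof.
move=> ab cv va hv.
pose w r := v r - (k + c * (r - a)).
have cw r : a <= r <= b -> forall eps, 0 < eps ->
    exists2 d, 0 < d & forall x, `|x - r| < d -> `|w x - w r| < eps.
  move=> /cv cr; apply: continuous_dist; apply: cvgB => //.
  apply: cvgD; first exact: cvg_cst.
  by apply: cvgM; [exact: cvg_cst|apply: cvgB; [exact: cvg_id|exact: cvg_cst]].
suff : w b <= 0 by rewrite subr_le0.
pose S := [set r | a <= r <= b /\ forall r', a <= r' <= r -> w r' <= 0].
have Sa : S a.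
  split=> [|r' ar']; first by rewrite lexx.
  have -> : r' = a by lra.
  by rewrite /w subrr mulr0 addr0; lra.
have supS : has_sup S by split; [exists a|exists b => r [/andP[]]].
set s := sup S.
have as_ : a <= s by apply: ub_le_sup => //; case: supS.
have sb : s <= b by apply: ge_sup => [|r [/andP[]]]//; exists a.
have below r' : a <= r' < s -> w r' <= 0.
  move=> /andP[ar' r's].
  have [r [_ hr] r'r] := sup_gt (proj1 supS) r's.
  by apply: hr; rewrite ar' ltW.
have ws0 : w s <= 0.
  rewrite leNgt; apply/negP => ws.
  have sa : a < s.
    rewrite lt_neqAle as_ andbT; apply: contraTneq ws => <-.
    by rewrite -leNgt; case: Sa => _; apply; rewrite lexx.
  have [|d d0 hd] := cw s _ _ ws; first by rewrite as_.
  pose r' := Num.max a (s - d / 2).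
  have r's : r' < s by rewrite /r' gt_max sa/=; lra.
  have ar' : a <= r' by rewrite /r' le_max lexx.
  have sr' : s - d / 2 <= r' by rewrite /r' le_max lexx orbT.
  have : w r' <= 0 by apply: below; rewrite ar'.
  have : `|w r' - w s| < w s by apply: hd; rewrite ltr_norml; lra.
  by rewrite ltr_norml; lra.
have Ss r' : a <= r' <= s -> w r' <= 0.
  case/andP=> ar'; rewrite le_eqVlt => /predU1P[->//|r's].
  by apply: below; rewrite ar'.
have [sb'|bs] := ltP s b; last by have -> : b = s by lra.
have [d d0 hd] : exists2 d, 0 < d & forall e, 0 < e < d -> w (s + e) <= 0.
  have [ws|ws] := ltP (w s) 0.
    have [||d d0 hd] := cw s _ (- w s); [by rewrite as_|lra|].
    exists d => // e ed; have : `|w (s + e) - w s| < - w s.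
      by apply: hd; rewrite addrAC subrr add0r gtr0_norm; lra.
    by rewrite ltr_norml; lra.
  have vs : v s = k + c * (s - a) by rewrite /w in ws ws0; lra.
  have [l lc hl] := hv s ltac:(by rewrite as_) vs.
  have cl0 : 0 < c - l by rewrite subr_gt0.
  have [d d0 hd] := hl _ cl0; exists d => // e /hd.
  by rewrite /w vs; lra.
exfalso; pose r := Num.min b (s + d / 2).
have rb : r <= b by rewrite /r ge_min lexx.
have sr : s < r by rewrite /r lt_min sb'/=; lra.
have rd : r <= s + d / 2 by rewrite /r ge_min lexx orbT.
suff : S r by move=> Sr; have := ub_le_sup (proj2 supS) Sr; rewrite -/s; lra.
split=> [|r' r'r]; first by lra.
have [r's|sr'] := leP r' s; first by apply: Ss; lra.
have -> : r' = s + (r' - s) by lra.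
by apply: hd; lra.
Qed.

(** The strict inequality demanded by [dini_comparison] is bought with the slope
    [l + eps / (b - a)], which costs only [eps] over the whole interval. *)
Lemma dini_increment v a b l : a <= b ->
  (forall r, a <= r <= b -> {for r, continuous v}) ->
  (forall r, a <= r < b -> dini_le v r l) ->
  v b - v a <= l * (b - a).
Proof.
move=> ab cv hv; apply/ler_addgt0Pr => eps eps0.
have [->|neq] := eqVneq a b; first by rewrite !subrr mulr0; lra.
have ba : 0 < b - a by lra.
have := @dini_comparison v a b (v a) (l + eps / (b - a)) ab cv (lexx _).
have -> : (l + eps / (b - a)) * (b - a) = l * (b - a) + eps by field; lra.
rewrite lerBlDl addrA; apply=> r arb _.
by exists l; [rewrite ltrDl divr_gt0|exact: hv].
Qed.

(* The maximum [M] of [v] satisfies [M <= (L * M + A) * (b - a)], which the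
   smallness of [L * (b - a)] turns into a bound on [M]. *)
Lemma dini_gronwall v a b L A : a <= b -> 0 <= L -> L * (b - a) <= 2^-1 ->
  0 <= A -> v a = 0 -> (forall r, a <= r <= b -> 0 <= v r) ->
  (forall r, a <= r <= b -> {for r, continuous v}) ->
  (forall r, a <= r < b -> dini_le v r (L * v r + A)) ->
  v b <= 2 * A * (b - a).
Proof.
move=> ab L0 Lab A0 va v0 cv hv.
have [|c cab hc] := @EVT_max R v a b ab.
  by apply: continuous_in_subspaceT => x; rewrite inE/= in_itv/=; exact: cv.
have {}cab : a <= c <= b by move: cab; rewrite in_itv.
have {}hc r : a <= r <= b -> v r <= v c by move=> rab; apply: hc; rewrite in_itv.
have inc r : a <= r <= b -> v r <= (L * v c + A) * (r - a).
  move=> rab; have := @dini_increment v a r (L * v c + A).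
  rewrite va subr0; apply; [lra|by move=> x ?; apply: cv; lra|].
  move=> x xr; apply: dini_le_weaken (hv x _); last by lra.
  by rewrite lerD2r ler_wpM2l// hc//; lra.
have vc0 := v0 _ cab.
have LA0 : 0 <= L * v c + A by rewrite addr_ge0// mulr_ge0.
have hvc : v c <= (L * v c + A) * (b - a).
  by apply: le_trans (inc _ cab) _; rewrite ler_wpM2l//; lra.
have : L * (b - a) * v c <= 2^-1 * v c by rewrite ler_wpM2r.
have := hc b; rewrite lexx ab => /(_ isT).
lra.
Qed.

End dini.

(** * The squared model function near 0 *)

Section model_distance.
Context {R : realType}.
Implicit Types (K N c x eps : R) (h : R -> R).

(* The factor 4 makes [qKN K N x] asymptotic to [x ^+ 2] at 0. *)
Definition qKN K N x : R := 4 * sKN K N (x / 2) ^+ 2.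

Lemma is_derive1_linear h : is_derive (0 : R) (1 : R) h (1 : R) -> h 0 = 0 ->
  forall eps, 0 < eps -> exists2 d, 0 < d &
    forall x, 0 <= x < d -> (1 - eps) * x <= h x <= (1 + eps) * x.
Proof.
move=> [hd h1] h0 eps eps0.
move: hd => /cvgrPdist_le/(_ _ eps0); rewrite -/(derive h 0 1) h1.
case/nbhs_ballP => d /= d0 hd; exists d => // x /andP[].
rewrite le_eqVlt => /predU1P[<-|x0] xd; first by rewrite h0 !mulr0 lexx.
have : `|1 - x^-1 *: (h (x *: 1 + 0) - h 0)| <= eps.
  by apply: hd; [rewrite /ball/= sub0r normrN gtr0_norm|rewrite gt_eqF].
rewrite h0 subr0 addr0 /GRing.scale/= mulr1 ler_norml => /andP[l1 l2].
have -> : h x = x^-1 * h x * x by rewrite mulrAC mulVf ?mul1r// gt_eqF.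
by rewrite !ler_pM2r//; lra.
Qed.

(* The product formula, shared by sin and sinh, turns the increment of [h ^+ 2]
   into the product of [h] at the sum and at the difference of the arguments. *)
Lemma sqr_model_increments h c : 0 < c ->
  is_derive (0 : R) (1 : R) h (1 : R) -> h 0 = 0 ->
  (forall a b, h (a + b) * h (a - b) = h a ^+ 2 - h b ^+ 2) ->
  forall eps, 0 < eps < 1 -> exists2 d, 0 < d &
    forall x x', 0 <= x <= x' -> x' < d ->
      (1 - eps) * (x' ^+ 2 - x ^+ 2) <=
        4 * (h (x' / 2 * c) / c) ^+ 2 - 4 * (h (x / 2 * c) / c) ^+ 2
      <= (1 + eps) * (x' ^+ 2 - x ^+ 2).
Proof.
move=> c0 h1 h0 hh eps eps01.
(* The linear bound is used twice, at the sum and at the difference; for [eps < 1] the squares of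
   [1 - eps / 3] and [1 + eps / 3] stay between [1 - eps] and [1 + eps]. *)
have [|d d0 hd] := is_derive1_linear h1 h0 (eps := eps / 3); first by lra.
exists (d / c); first by rewrite divr_gt0.
move=> x x' xx'; rewrite ltr_pdivlMr// => x'd.
have u0 : 0 <= x / 2 * c <= x' / 2 * c.
  by apply/andP; split; [rewrite mulr_ge0//; lra|rewrite ler_pM2r//; lra].
have := hd (x' / 2 * c + x / 2 * c) ltac:(lra).
have := hd (x' / 2 * c - x / 2 * c) ltac:(lra).
set u := x' / 2 * c - x / 2 * c; set w := x' / 2 * c + x / 2 * c => hu hw.
have -> : 4 * (h (x' / 2 * c) / c) ^+ 2 - 4 * (h (x / 2 * c) / c) ^+ 2 =
          4 * (h w * h u) / c ^+ 2.
  have -> : h w * h u = h (x' / 2 * c) ^+ 2 - h (x / 2 * c) ^+ 2 by exact: hh.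
  by field; lra.
have -> : x' ^+ 2 - x ^+ 2 = 4 * (w * u) / c ^+ 2 by rewrite /w /u; field; lra.
have w0 : 0 <= w by rewrite /w; lra.
have u0' : 0 <= u by rewrite /u; lra.
have wu0 : 0 <= w * u by rewrite mulr_ge0.
have lo : (1 - eps) * (w * u) <= h w * h u.
  apply: (@le_trans _ _ (((1 - eps / 3) * w) * ((1 - eps / 3) * u))).
    rewrite mulrACA ler_wpM2r//; nra.
  by rewrite ler_pM ?mulr_ge0//; lra.
have hi : h w * h u <= (1 + eps) * (w * u).
  apply: (@le_trans _ _ (((1 + eps / 3) * w) * ((1 + eps / 3) * u))).
    have : (1 - eps / 3) * w <= h w by lra.
    have : (1 - eps / 3) * u <= h u by lra.
    have : 0 <= (1 - eps / 3) * w by rewrite mulr_ge0//; lra.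
    have : 0 <= (1 - eps / 3) * u by rewrite mulr_ge0//; lra.
    by move=> *; rewrite ler_pM//; lra.
  rewrite mulrACA ler_wpM2r//; nra.
have c2 : 0 < c ^+ 2 by rewrite exprn_gt0.
by rewrite !mulrA !ler_pM2r ?invr_gt0// -!mulrA -![_ * (4 * _)]mulrCA !ler_pM2l//; lra.
Qed.

Lemma qKN0 K N : qKN K N 0 = 0.
Proof.
rewrite /qKN /sKN mul0r; case: ifP => _; first by rewrite mul0r sin0 mul0r expr0n/= mulr0.
case: ifP => _; first by rewrite expr0n/= mulr0.
by rewrite /sinh mul0r oppr0 subrr !mul0r expr0n/= mulr0.
Qed.

Lemma qKN_ge0 K N x : 0 <= qKN K N x.
Proof. by rewrite mulr_ge0// sqr_ge0. Qed.

Lemma continuous_qKN K N : continuous (qKN K N).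
Proof.
have half (x : R) : {for x, continuous (fun x : R => x / 2)}.
  by apply: cvgM; [exact: cvg_id|exact: cvg_cst].
have scal (x c : R) : {for x, continuous (fun x : R => x / 2 * c)}.
  by apply: cvgM; [exact: half|exact: cvg_cst].
suff cs (x : R) : {for x, continuous (fun x => sKN K N (x / 2))}.
  move=> x; apply: cvgM; first exact: cvg_cst.
  by apply: (@continuous_comp _ _ _ (fun x => sKN K N (x / 2)) (fun y => y ^+ 2)); [exact: cs|exact: exprn_continuous].
rewrite /sKN; case: (K < 0) => /=.
  apply: cvgM; last exact: cvg_cst.
  by apply: continuous_comp; [exact: scal|exact: continuous_sin].
case: (K == 0) => /=; first exact: half.
apply: cvgM; last exact: cvg_cst.
apply: cvgM; last exact: cvg_cst.
apply: cvgB.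
  by apply: continuous_comp; [exact: scal|exact: continuous_expR].
apply: continuous_comp; last exact: continuous_expR.
by apply: cvgN; exact: scal.
Qed.

Lemma sinh_mul (a b : R) : sinh (a + b) * sinh (a - b) = sinh a ^+ 2 - sinh b ^+ 2.
Proof.
rewrite /sinh opprB opprD !expRD.
have ha : expR a * expR (- a) = 1 by rewrite -expRD subrr expR0.
have hb : expR b * expR (- b) = 1 by rewrite -expRD subrr expR0.
move: ha hb; set A := expR a; set A' := expR (- a); set B := expR b; set B' := expR (- b).
move=> ha hb; have -> : (A * B - A' * B') / 2 * ((A * B' - B * A') / 2) =
  (A ^+ 2 * (B * B') - (B ^+ 2 + B' ^+ 2) * (A * A') + A' ^+ 2 * (B * B')) / 4 by field.
rewrite ha hb.
have -> : ((A - A') / 2) ^+ 2 - ((B - B') / 2) ^+ 2 =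
  (A ^+ 2 + A' ^+ 2 - (A * A') *+ 2 - B ^+ 2 - B' ^+ 2 + (B * B') *+ 2) / 4 by field.
by rewrite ha hb; field.
Qed.

Lemma sin_mul (a b : R) : sin (a + b) * sin (a - b) = sin a ^+ 2 - sin b ^+ 2.
Proof.
rewrite sinD sinB.
have -> : (sin a * cos b + cos a * sin b) * (sin a * cos b - cos a * sin b) =
  sin a ^+ 2 * cos b ^+ 2 - cos a ^+ 2 * sin b ^+ 2 by ring.
by rewrite !cos2sin2; ring.
Qed.

Lemma is_derive_sinh0 : is_derive (0 : R) (1 : R) sinh (1 : R).
Proof.
have -> : @sinh R = (2^-1 *: (expR - (expR \o -%R))).
  by apply/funext => x; rewrite /sinh mulrC.
apply: is_derive_eq.
rewrite oppr0 expR0 /GRing.scale/=; lra.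
Qed.

(** Increments, and not only values, are compared: the EVI controls the growth of [qKN] of the
    distance to a fixed point, and this turns it into growth of the squared distance. *)
Lemma qKN_increments K N : N < 0 ->
  forall eps, 0 < eps < 1 -> exists2 d, 0 < d &
    forall x x', 0 <= x <= x' -> x' < d ->
      (1 - eps) * (x' ^+ 2 - x ^+ 2) <= qKN K N x' - qKN K N x
      <= (1 + eps) * (x' ^+ 2 - x ^+ 2).
Proof.
move=> N0 eps eps01; rewrite /qKN /sKN.
have [K0|K0|_] := ltgtP K 0.
- have c0 : 0 < Num.sqrt (K / N) by rewrite sqrtr_gt0 nmulr_lgt0// invr_lt0.
  apply: sqr_model_increments => //; [|exact: sin0|exact: sin_mul].
  by apply: is_derive_eq; rewrite cos0.
- have c0 : 0 < Num.sqrt (- K / N) by rewrite sqrtr_gt0 nmulr_lgt0 ?invr_lt0//; lra.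
  apply: sqr_model_increments => //; [exact: is_derive_sinh0| |exact: sinh_mul].
  by rewrite /sinh oppr0 subrr mul0r.
exists 1 => // x x' xx' _.
have -> : 4 * (x' / 2) ^+ 2 - 4 * (x / 2) ^+ 2 = x' ^+ 2 - x ^+ 2 by field.
have : x ^+ 2 <= x' ^+ 2 by rewrite lerXn2r ?nnegrE; lra.
by move=> ?; apply/andP; split; nra.
Qed.

End model_distance.

Lemma dini_le_scale {R : realType} (v : R -> R) (r l k : R) : 0 <= k ->
  dini_le v r l -> dini_le (fun s => k * v s) r (k * l).
Proof.
rewrite le_eqVlt => /predU1P[<- _ eps eps0|k0 h eps eps0].
  by exists 1 => // e /andP[e0 _]; rewrite !mul0r subr0 add0r mulr_ge0// ltW.
have [|d d0 hd] := h (eps / k); first by rewrite divr_gt0.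
exists d => // e /hd; rewrite -(ler_pM2l k0) mulrBr => /le_trans; apply.
by rewrite mulrA mulrDr mulrCA divff ?mulr1// gt_eqF.
Qed.

Lemma timespan_convex {R : realType} (T : \bar R) (a b r : R) :
  timespan T a -> timespan T b -> a <= r <= b -> timespan T r.
Proof.
move=> [a0 _] [_ bT] /andP[ar rb]; split; first exact: lt_le_trans ar.
by apply: le_lt_trans bT; rewrite lee_fin.
Qed.

Lemma open_timespan {R : realType} (T : \bar R) : open (timespan T).
Proof.
have -> : timespan T = `]0, +oo[%classic `&` (EFin @^-1` [set x | (x < T)%E]).
  by apply/seteqP; split=> r /=; rewrite in_itv/= andbT.
apply: openI; first exact: interval_open.
case: T => [T| |].
- have -> : EFin @^-1` [set x | (x < T%:E)%E] = `]-oo, T[%classic.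
    by apply/seteqP; split=> r /=; rewrite lte_fin in_itv.
  exact: interval_open.
- have -> : EFin @^-1` [set x | (x < +oo)%E] = [set: R].
    by apply/seteqP; split=> r //= _; rewrite ltry.
  exact: openT.
- have -> : EFin @^-1` [set x | (x < -oo)%E] = (set0 : set R).
    by apply/seteqP; split=> r //=; rewrite ltNge leNye.
  exact: open0.
Qed.

Lemma timespan_ball {R : realType} (T : \bar R) (t : R) : timespan T t ->
  exists2 d, 0 < d & forall r, `|r - t| < d -> timespan T r.
Proof.
move=> Tt; have /nbhs_ballP[d /= d0 hd] := open_nbhs_nbhs (conj (@open_timespan R T) Tt).
by exists d => // r rt; apply: hd; rewrite /ball/= distrC.
Qed.

(** * Continuity of curves in a metric space *)

Section metric_curve.
Context {R : realType} {X : metricType R}.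
Implicit Types (y : R -> X) (z : X) (a b s t r : R).

Lemma mdist_dist x x' z : `|mdist x z - mdist x' z| <= mdist x x' :> R.
Proof.
have := @metric_triangle R X x x' z; have := @metric_triangle R X x' x z.
by rewrite (@metric_sym R X x' x) ler_norml; lra.
Qed.

Lemma continuous_mdist y t : {for t, continuous y} ->
  forall eps, 0 < eps ->
    exists2 d, 0 < d & forall s, `|s - t| < d -> mdist (y s) (y t) < eps.
Proof.
move=> cy eps eps0.
have : nbhs t [set s | mdist (y t) (y s) < eps].
  exact: (metricType_numDomainType.cvgr_dist_lt cy eps0).
case/nbhs_ballP => d /= d0 hd; exists d => // s st.
by rewrite metric_sym; apply: hd; rewrite /ball/= distrC.
Qed.

Lemma continuous_mdistl y z t : {for t, continuous y} ->
  {for t, continuous (fun s => mdist (y s) z)}.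
Proof.
move=> cy; apply/cvgrPdist_lt => eps /(continuous_mdist cy)[d d0 hd].
apply/nbhs_ballP; exists d => // s; rewrite /ball/= distrC => /hd.
by rewrite distrC; apply: le_lt_trans; exact: mdist_dist.
Qed.

Lemma curve_uniform_continuity y a b :
  (forall r, a <= r <= b -> {for r, continuous y}) ->
  forall eps, 0 < eps -> exists2 d, 0 < d &
    forall s t, a <= s <= b -> a <= t <= b -> `|s - t| < d ->
      mdist (y s) (y t) < eps.
Proof.
move=> cy eps eps0.
(* Compactness in covering form, with the modulus of continuity as the parameter that tends to 0. *)
have /compact_near_coveringP := @segment_compact R a b.
move=> /(_ R (0 : R)^'+ (fun d s => forall t, a <= t <= b -> `|s - t| < d ->
  mdist (y s) (y t) < eps)) H.
have {}H : \forall d \near (0 : R)^'+, `[a, b] `<=` (fun s => forall t,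
    a <= t <= b -> `|s - t| < d -> mdist (y s) (y t) < eps).
  apply: H => x; rewrite /= in_itv/= => /cy cx.
  have eps2 : 0 < eps / 2 by rewrite divr_gt0.
  have [d d0 hd] := continuous_mdist cx eps2; near=> s e => /= t tab ste.
  have hs : mdist (y s) (y x) < eps / 2.
    by apply: hd; rewrite distrC; near: s; exact: nbhsx_ballx.
  have ht : mdist (y t) (y x) < eps / 2.
    apply: hd; rewrite distrC.
    have : `|x - s| < d / 2 by near: s; apply: (@nbhsx_ballx _ _ x (d / 2)); rewrite divr_gt0.
    have : e < d / 2 by near: e; apply: nbhs_right_lt; rewrite divr_gt0.
    by have := ler_distD s x t; lra.
  have := metric_triangle (y s) (y x) (y t).
  by rewrite (metric_sym (y x)); lra.
have /near_right0P[d d0 hd] := H.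
exists (d / 2); first by rewrite divr_gt0.
move=> s t sab tab st; by apply: (hd (d / 2)) => //; lra.
Unshelve. all: by end_near. Qed.

End metric_curve.

(** * Numerical inequalities behind the growth estimates *)

Section growth_arithmetic.
Context {R : realType}.
Implicit Types (theta eps k h p x c w : R).

(** The terms in [k * x] cost at most [eps * c], so all reduces to
    [1 + eps < (1 - 2 * eps) * (1 + 9 * eps)], true for [0 < eps < 3^-1]. This is the origin of the
    9. *)
Lemma growth_rate_lt theta eps k h p x c :
  1 <= theta -> 0 < eps < 3^-1 -> 0 <= k -> 0 <= h -> 6 * (theta * k * h) <= eps ->
  0 < c -> theta * (1 + 9 * eps) * p <= c -> 0 <= x <= 2 * (c * h) ->
  theta * (1 + eps) * (p + k * x) + k * x < c * (1 - eps).
Proof.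
move=> th1 eps13 k0 h0 Kh c0 cp x2.
have Kx : 3 * (theta * (k * x)) <= eps * c.
  have /ler_wpM2l/(_ x (2 * (c * h))) : 0 <= theta * k by rewrite mulr_ge0//; lra.
  have : 6 * (theta * k * h) * c <= eps * c by rewrite ler_pM2r.
  by case/andP: x2 => _ x2 + /(_ x2); lra.
have kx0 : 0 <= k * x by rewrite mulr_ge0//; lra.
have tkx : k * x <= theta * (k * x) by rewrite ler_peMl.
have tkxe : theta * (k * x) * eps <= theta * (k * x).
  by rewrite ler_piMr//; [rewrite mulr_ge0//; lra|lra].
have cpe : (theta * (1 + 9 * eps) * p) * (1 + eps) <= c * (1 + eps).
  by rewrite ler_pM2r//; lra.
have ce : 0 < c * (eps * (6 - 18 * eps)) by rewrite !mulr_gt0//; lra.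
suff : theta * (1 + eps) * p < c * (1 - 2 * eps) by lra.
rewrite -(ltr_pM2r (_ : 0 < 1 + 9 * eps)); lra.
Qed.

Lemma growth_excess_le theta eps k h p x :
  1 <= theta -> 0 < eps < 3^-1 -> 0 <= k -> 6 * (theta * k * h) <= eps ->
  0 <= p -> 0 <= x <= theta * (1 + 9 * eps) * p * h ->
  theta * ((1 + eps) * (p * x + k * x ^+ 2)) <=
    theta ^+ 2 * (1 + 9 * eps) ^+ 2 * p ^+ 2 * h.
Proof.
move=> th1 eps13 k0 Kh p0 /andP[x0 Dh]; have th0 : 0 <= theta by lra.
have Kx : k * x <= 3 * eps * p.
  have a1 : k * x <= k * (theta * (1 + 9 * eps) * p * h) by rewrite ler_wpM2l.
  have a2 : 6 * (theta * k * h) * ((1 + 9 * eps) * p) <= eps * ((1 + 9 * eps) * p).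
    by rewrite ler_wpM2r// mulr_ge0//; lra.
  have a3 : (1 + 9 * eps) * (eps * p) <= 4 * (eps * p).
    by rewrite ler_wpM2r ?mulr_ge0//; lra.
  have : 0 <= eps * p by rewrite mulr_ge0//; lra.
  lra.
have b1 : p * x + k * x ^+ 2 <= (1 + 3 * eps) * p * x.
  have : k * x * x <= 3 * eps * p * x by rewrite ler_wpM2r.
  rewrite expr2; lra.
have b2 : (1 + eps) * (1 + 3 * eps) <= 1 + 9 * eps by nra.
have px0 : 0 <= p * x by rewrite mulr_ge0.
have b3 : (1 + eps) * (p * x + k * x ^+ 2) <= (1 + 9 * eps) * (p * x).
  apply: (@le_trans _ _ ((1 + eps) * ((1 + 3 * eps) * p * x))).
    by rewrite ler_wpM2l//; lra.
  by rewrite -!mulrA mulrA ler_wpM2r.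
have b4 : (1 + 9 * eps) * (p * x) <=
    (1 + 9 * eps) * (p * (theta * (1 + 9 * eps) * p * h)).
  by rewrite ler_wpM2l; [|lra|rewrite ler_wpM2l].
have := ler_wpM2l th0 (le_trans b3 b4).
by move/le_trans; apply; lra.
Qed.

(* Where [v > 0], [v ^+ 2] grows at least [2 * v] times as fast as [v]. *)
Lemma dini_sqr (u v : R -> R) eps eta r l w : 0 < eps < 1 -> 0 <= w ->
  (forall x x', 0 <= x <= x' -> x' < eta ->
     (1 - eps) * (x' ^+ 2 - x ^+ 2) <= u x' - u x) ->
  {for r, continuous v} -> 0 < v r < eta ->
  dini_le (fun s => u (v s)) r l -> l <= 2 * v r * w ->
  dini_le v r (w / (1 - eps)).
Proof.
move=> eps01 w0 hu cv; set x := v r => /andP[x0 xeta] hd lw e1 e10.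
have pos : 0 < 2 * (1 - eps) * x by rewrite !mulr_gt0//; lra.
have [d d0 hdini] := hd (2 * (1 - eps) * x * e1) ltac:(by rewrite mulr_gt0).
have [|d' d'0 hd'] := continuous_dist cv (eps := eta - x); first by rewrite subr_gt0.
exists (Num.min d d') => [|e /andP[egt0]]; first by rewrite lt_min d0.
rewrite lt_min => /andP[ed ed'].
have [x'x|xx'] := leP (v (r + e)) x.
  apply: (@le_trans _ _ 0); first by rewrite subr_le0.
  by rewrite mulr_ge0 ?(ltW egt0)// addr_ge0 ?(ltW e10)// divr_ge0//; lra.
have x'eta : v (r + e) < eta.
  have : `|v (r + e) - x| < eta - x by apply: hd'; rewrite addrAC subrr add0r gtr0_norm.
  by rewrite ltr_norml; lra.
have := hdini e ltac:(by rewrite egt0); rewrite -/x.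
set x' := v (r + e) in xx' x'eta *.
have := hu x x'; rewrite (ltW x0) (ltW xx') => /(_ isT x'eta) lo up.
rewrite -(ler_pM2l pos) mulrA.
have -> : 2 * (1 - eps) * x * (w / (1 - eps) + e1) = 2 * x * w + 2 * (1 - eps) * x * e1.
  by field; lra.
have upw : (l + 2 * (1 - eps) * x * e1) * e <=
    (2 * x * w + 2 * (1 - eps) * x * e1) * e by rewrite ler_pM2r// lerD2r.
apply: le_trans upw; apply: le_trans up; apply: le_trans lo.
rewrite -mulrA mulrCA -!mulrA ler_pM2l; last by lra.
rewrite mulrCA.
have -> : x' ^+ 2 - x ^+ 2 = (x' + x) * (x' - x) by ring.
by rewrite !mulrA ler_wpM2r//; lra.
Qed.

(** Meant for [A = (p * h) ^+ 2] and [B] the energy loss times [h]. The left side is about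
    [2 * tau * A]; the tolerance [tau ^+ 2 / 10] keeps all errors of order [tau ^+ 2], hence of
    order [tau] after division by [2 * tau]. *)
Lemma two_stage_arithmetic (tau A B : R) : 0 < tau < 1 -> 0 <= A ->
  (1 - tau ^+ 2 / 10) ^+ 3 * A - (1 + tau ^+ 2 / 10) ^+ 3 * (1 - tau) ^+ 2 * A <=
    2 * (1 + tau ^+ 2 / 10) * B * tau + tau ^+ 2 * A ->
  (1 - 2 * tau) * A <= B.
Proof.
move=> tau01 A0; have t2 : tau ^+ 2 <= tau by nra.
have : 0 < tau ^+ 2 by rewrite exprn_gt0; lra.
set e := tau ^+ 2 / 10 => tt0 h; have e01 : 0 < e < 10^-1 by rewrite /e; lra.
have lo : 1 - 3 * e <= (1 - e) ^+ 3.
  have -> : (1 - e) ^+ 3 = 1 - 3 * e + e ^+ 2 * (3 - e) by ring.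
  by rewrite lerDl mulr_ge0 ?sqr_ge0//; lra.
have hi : (1 + e) ^+ 3 * (1 - tau) ^+ 2 <= (1 - tau) ^+ 2 + 7 * e.
  have h1 : (1 + e) ^+ 3 <= 1 + 7 * e by nra.
  have h2 : (1 - tau) ^+ 2 <= 1 by nra.
  have := ler_wpM2r (sqr_ge0 (1 - tau)) h1; nra.
have loA := ler_wpM2r A0 lo; have hiA := ler_wpM2r A0 hi.
have key : (2 * tau - 2 * tau ^+ 2) * A <= 2 * (1 + e) * B * tau + tau ^+ 2 * A.
  have : 10 * e * A = tau ^+ 2 * A by rewrite /e; field.
  by lra.
have tau0 : 0 < tau by lra.
have key2 : (1 - 3 / 2 * tau) * A <= (1 + e) * B.
  by rewrite -(ler_pM2l tau0); lra.
rewrite -(ler_pM2l (_ : 0 < 1 + e)); last by lra.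
apply: le_trans key2; rewrite mulrA ler_wpM2r//; rewrite /e; nra.
Qed.

Lemma sqr_growth_le8 (e p x h : R) : 0 < e < 1 -> 0 <= x <= h ->
  (1 + e) * ((1 + e) * p * x) ^+ 2 <= 8 * (p * h) ^+ 2.
Proof.
move=> e01 xh.
have hx : x ^+ 2 <= h ^+ 2 by rewrite lerXn2r ?nnegrE; lra.
have e8 : (1 + e) ^+ 3 <= 2 ^+ 3 by rewrite lerXn2r ?nnegrE; lra.
have -> : (1 + e) * ((1 + e) * p * x) ^+ 2 = (1 + e) ^+ 3 * (p ^+ 2 * x ^+ 2) by ring.
rewrite exprMn ler_pM//; last by rewrite ler_wpM2l ?sqr_ge0.
- by rewrite exprn_ge0//; lra.
- by rewrite mulr_ge0 ?sqr_ge0.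
- by lra.
Qed.

End growth_arithmetic.

(** * Integrals of difference quotients *)

Section difference_quotients.
Context {R : realType}.
Local Notation mu := (@lebesgue_measure R).
Implicit Types (f phi : R -> R) (a b s t h M eps : R).

Local Notation shift h :=
  ((fun x => x + h) : measurableTypeR R -> measurableTypeR R).

Lemma measurable_shift h : measurable_fun [set: measurableTypeR R] (shift h).
Proof. by apply: measurable_funD => //; exact: measurable_cst. Qed.

Lemma lebesgue_measure_shift h (A : set R) : measurable A ->
  pushforward mu (shift h) A = mu A.
Proof.
move=> mA; apply/esym/lebesgue_measure_unique => //.
  exact: measurable_shift.
move=> ms _ [[a b] _ <-]/=; rewrite /pushforward.
have -> : (fun x => x + h) @^-1` `]a, b]%classic = `](a - h), (b - h)]%classic.
  by apply/seteqP; split=> x /=; rewrite !in_itv/= ltrBlDr lerBrDr.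
rewrite !lebesgue_measure_itv/= !lte_fin ltrD2r; case: ifP => // _.
by rewrite -!EFinB; congr EFin; ring.
Qed.

Lemma bounded_measurable_integrable phi M (A : set R) : measurable A ->
  (mu A < +oo)%E -> measurable_fun [set: R] phi -> (forall r, `|phi r| <= M) ->
  mu.-integrable A (EFin \o phi).
Proof.
move=> mA Aoo mphi bphi; apply: measurable_bounded_integrable => //.
  exact: measurable_funTS.
by exists M; split; [exact: num_real|move=> x Mx r _ /=; exact: le_trans (bphi r) (ltW Mx)].
Qed.

Lemma lebesgue_measure_segment_lty a b : (mu `[a, b] < +oo)%E.
Proof. by rewrite lebesgue_measure_itv/=; case: ifP => // _; rewrite -EFinB ltry. Qed.

Lemma Rintegral_shift phi M a b h : measurable_fun [set: R] phi ->
  (forall r, `|phi r| <= M) ->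
  \int[mu]_(r in `[a, b]) phi (r + h) = \int[mu]_(r in `[a + h, b + h]) phi r.
Proof.
move=> mphi bphi; rewrite /Rintegral; congr fine.
have preE : (fun x => x + h) @^-1` `[a + h, b + h]%classic = `[a, b]%classic.
  by apply/seteqP; split=> x /=; rewrite !in_itv/= !lerD2r.
have mshift : measurable_fun [set: measurableTypeR R] (shift h) := @measurable_shift h.
have -> : (\int[mu]_(r in `[(a + h)%R, (b + h)%R]) (phi r)%:E =
  \int[pushforward mu (shift h)]_(r in `[(a + h)%R, (b + h)%R]) (phi r)%:E)%E.
  by apply: eq_measure_integral => // A mA _; exact/esym/lebesgue_measure_shift.
rewrite (@integral_pushforward _ _ _ _ _ (shift h) mshift mu _ (EFin \o phi)) ?preE//.
  exact/measurable_EFinP.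
apply: (@bounded_measurable_integrable (phi \o shift h) M) => //.
- exact: lebesgue_measure_segment_lty.
- exact: measurableT_comp.
- by move=> r /=.
Qed.

Lemma Rintegral_mean_dist phi M t h eps : 0 < h -> measurable_fun [set: R] phi ->
  (forall r, `|phi r| <= M) ->
  (forall r, t <= r <= t + h -> `|phi r - phi t| <= eps) ->
  `|h^-1 * \int[mu]_(r in `[t, t + h]) phi r - phi t| <= eps.
Proof.
move=> h0 mphi bphi he.
have lty := lebesgue_measure_segment_lty t (t + h).
have muE : fine (mu `[t, t + h]) = h.
  by rewrite lebesgue_measure_itv/= lte_fin ltrDl h0 /= addrAC subrr add0r.
have intphi := @bounded_measurable_integrable phi M `[t, t + h] ltac:(by []) lty mphi bphi.
have intc c : mu.-integrable `[t, t + h] (EFin \o cst c).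
  by apply: (@bounded_measurable_integrable _ `|c|) => //; exact: measurable_cst.
have intB : mu.-integrable `[t, t + h] (EFin \o (fun r => phi r - phi t)).
  apply: (@bounded_measurable_integrable _ (M + M)) => //.
    by apply: measurable_funB => //; exact: measurable_cst.
  by move=> r; rewrite (le_trans (ler_normB _ _))// lerD.
have -> : h^-1 * \int[mu]_(r in `[t, t + h]) phi r - phi t =
    h^-1 * \int[mu]_(r in `[t, t + h]) (phi r - phi t).
  rewrite RintegralB//; last exact: intc.
  by rewrite Rintegral_cst// muE mulrBr mulrCA mulVf ?mulr1// gt_eqF.
have hV : `|h^-1| = h^-1 by rewrite ger0_norm// invr_ge0 ltW.
rewrite normrM hV ler_pdivrMl// [leRHS]mulrC.
apply: le_trans (le_normr_Rintegral _ _) _ => //.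
have -> : eps * h = \int[mu]_(r in `[t, t + h]) (cst eps r).
  by rewrite Rintegral_cst// muE.
by apply: le_Rintegral => //; exact: integrable_norm.
Qed.

(** Right limits are sampled at the steps [k.+1%:R^-1], because Fatou's lemma and dominated
    convergence are about sequences. *)
Lemma cvg_harmonic_right (P : R -> Prop) :
  (exists2 d, 0 < d & forall h, 0 < h < d -> P h) ->
  \forall k \near \oo, P k.+1%:R^-1.
Proof.
move=> [d d0 hd]; near=> k; apply: hd; rewrite invr_gt0 ltr0n/=.
near: k; have /cvgrPdist_lt/(_ d d0) := @cvg_harmonic R.
by apply: filterS => k; rewrite sub0r normrN ger0_norm// invr_ge0.
Unshelve. all: by end_near. Qed.

(** After a translation the integral telescopes to the mean of [phi] over a short interval right of
    [t] minus the mean right of [s]; right continuity gives the limits of both. *)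
Lemma cvg_Rintegral_difference_quotient phi M s t : s <= t ->
  measurable_fun [set: R] phi -> (forall r, `|phi r| <= M) ->
  (forall eps, 0 < eps -> exists2 d, 0 < d &
     forall r, s <= r < s + d -> `|phi r - phi s| <= eps) ->
  (forall eps, 0 < eps -> exists2 d, 0 < d &
     forall r, t <= r < t + d -> `|phi r - phi t| <= eps) ->
  (\int[mu]_(r in `[s, t]) (k.+1%:R * (phi (r + k.+1%:R^-1) - phi r)))
     @[k --> \oo] --> phi t - phi s.
Proof.
move=> st mphi bphi cs ct.
have mshift h : measurable_fun [set: R] (fun r => phi (r + h)).
  exact: (measurableT_comp mphi (measurable_shift h)).
have intB h : mu.-integrable `[s, t] (EFin \o (fun r => phi (r + h) - phi r)).
  apply: (@bounded_measurable_integrable _ (M + M)) => //.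
  - exact: lebesgue_measure_segment_lty.
  - exact: measurable_funB.
  - by move=> r; rewrite (le_trans (ler_normB _ _))// lerD.
have int a b : mu.-integrable `[a, b] (EFin \o phi).
  by apply: (@bounded_measurable_integrable _ M) => //; exact: lebesgue_measure_segment_lty.
have intsh h a b : mu.-integrable `[a, b] (EFin \o (fun r => phi (r + h))).
  by apply: (@bounded_measurable_integrable _ M) => //; exact: lebesgue_measure_segment_lty.
have E k : \int[mu]_(r in `[s, t]) (k.+1%:R * (phi (r + k.+1%:R^-1) - phi r)) =
   (k.+1%:R^-1)^-1 * \int[mu]_(r in `[t, t + k.+1%:R^-1]) phi r -
   (k.+1%:R^-1)^-1 * \int[mu]_(r in `[s, s + k.+1%:R^-1]) phi r.
  set h := k.+1%:R^-1; have h0 : 0 < h by rewrite invr_gt0.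
  rewrite RintegralZl//.
  rewrite RintegralB// (Rintegral_shift _ _ _ mphi bphi) -mulrBr invrK; congr (_ * _).
  have B1 := @Rintegral_itvB R phi (BLeft s) (BRight (t + h)) (s + h) (int _ _).
  have B2 := @Rintegral_itvB R phi (BLeft s) (BRight (t + h)) t (int _ _).
  move: B1 B2; rewrite !bnd_simp.
  have -> : s <= s + h by lra.
  have -> : s + h <= t + h by lra.
  have -> : t <= t + h by lra.
  move=> /(_ isT isT) B1 /(_ st isT) B2.
  have obnd a b : \int[mu]_(x in `]a, b]) phi x = \int[mu]_(x in `[a, b]) phi x.
    apply: Rintegral_itv_obnd_cbnd; apply: integrableS (int a b) => //.
    by apply: subset_itvr; rewrite bnd_simp.
  by rewrite !obnd in B1 B2; lra.
apply/cvgrPdist_le => eps eps0.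
have e2 : 0 < eps / 2 by rewrite divr_gt0.
have mean u : (forall eps, 0 < eps -> exists2 d, 0 < d &
     forall r, u <= r < u + d -> `|phi r - phi u| <= eps) -> \forall k \near \oo,
   `|(k.+1%:R^-1)^-1 * \int[mu]_(r in `[u, u + k.+1%:R^-1]) phi r - phi u| <= eps / 2.
  move=> cu; have [d d0 hd] := cu _ e2.
  apply: (cvg_harmonic_right (P := fun h =>
    `|h^-1 * \int[mu]_(r in `[u, u + h]) phi r - phi u| <= eps / 2)).
  exists d => // h /andP[h0 hd']; apply: (Rintegral_mean_dist h0 mphi bphi) => r rh.
  by apply: hd; lra.
near=> k; rewrite E.
have : `|(k.+1%:R^-1)^-1 * \int[mu]_(r in `[s, s + k.+1%:R^-1]) phi r - phi s| <= eps / 2.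
  by near: k; exact: mean.
have : `|(k.+1%:R^-1)^-1 * \int[mu]_(r in `[t, t + k.+1%:R^-1]) phi r - phi t| <= eps / 2.
  by near: k; exact: mean.
by rewrite !ler_norml; lra.
Unshelve. all: by end_near. Qed.

End difference_quotients.

(** * Comparison of integrals without measurability *)

Section integral_ae.
Local Open Scope ereal_scope.
Context d (U : measurableType d) (R : realType).
Context (mu : {measure set U -> \bar R}).
Implicit Types (f : U -> \bar R) (D : set U).

Import HBNNSimple.

(* The functions are not assumed to be measurable: a simple function below [f1]
   becomes a simple function below [f2] when set to 0 on a null set. *)
Lemma ge0_ae_le_integralT f1 f2 : (forall x, 0 <= f1 x) -> (forall x, 0 <= f2 x) ->
  {ae mu, forall x, f1 x <= f2 x} -> \int[mu]_x f1 x <= \int[mu]_x f2 x.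
Proof.
move=> f10 f20 [A [mA A0 subA]]; rewrite !ge0_integralTE//.
apply: ge_ereal_sup => _ [h /= hf1 <-].
pose h' := proj_nnsfun h (measurableC mA).
have -> : sintegral mu h = sintegral mu h'.
  rewrite -!integralT_nnsfun; apply: ge0_ae_eq_integral => //.
  - by apply/measurable_EFinP.
  - by apply/measurable_EFinP.
  - by move=> x _; rewrite lee_fin.
  - by move=> x _; rewrite lee_fin.
  exists A; split => // x /= xA; apply: contrapT => nAx; apply: xA => _.
  by rewrite /h' /= mindicE mem_set ?mulr1.
apply: ereal_sup_ubound; exists h' => //= x.
rewrite mindicE; have [/set_mem nAx|_] := boolP (x \in ~` A).
  rewrite mulr1; apply: (le_trans (hf1 x)).
  by apply: contrapT => nle; apply: nAx; apply: subA.
by rewrite mulr0.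
Qed.

(** Meant for the dissipation, which contains the descending slope. *)
Lemma ge0_ae_eq_integral_nonmeasurable D f1 f2 :
  (forall x, 0 <= f1 x) -> (forall x, 0 <= f2 x) ->
  {ae mu, forall x, D x -> f1 x = f2 x} ->
  \int[mu]_(x in D) f1 x = \int[mu]_(x in D) f2 x.
Proof.
move=> f10 f20 f12; rewrite integral_mkcond [RHS]integral_mkcond.
have p0 f : (forall x, 0 <= f x) -> forall x, 0 <= (f \_ D) x.
  by move=> f0 x; rewrite patchE; case: ifP.
apply/eqP; rewrite eq_le; apply/andP; split; apply: ge0_ae_le_integralT;
  do ?[exact: p0]; apply: filterS f12 => x f12x;
  by rewrite !patchE; case: ifPn => // /set_mem/f12x ->.
Qed.

End integral_ae.

(** * Lower right derivatives of monotone functions *)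

Section drop_quotient.
Context {R : realType}.
Local Notation mu := (@lebesgue_measure R).
Implicit Types (G : R -> R) (a b r s t M : R) (T : \bar R).

Lemma limn_einf_lt (u : (\bar R)^nat) L : (limn_einf u < L)%E ->
  forall n, exists2 k, (n <= k)%N & (u k < L)%E.
Proof.
move=> uL n; apply: contrapT => hn.
have : (L <= einfs u n)%E.
  apply: le_ereal_inf_tmp => _ [k /= nk <-]; rewrite leNgt; apply/negP => ukL.
  by apply: hn; exists k.
rewrite leNgt => /negP; apply; apply: le_lt_trans uL.
rewrite limn_einf_lim.
have /cvg_lim -> := @cvg_einfs_sup R u; last exact: ereal_hausdorff.
by apply: ereal_sup_ubound; exists n.
Qed.

Definition drop_quotient G k r : R := k.+1%:R * (G r - G (r + k.+1%:R^-1)).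

Lemma measurable_drop_quotient G k : measurable_fun [set: R] G ->
  measurable_fun [set: R] (drop_quotient G k).
Proof.
move=> mG; apply: measurable_funM; first exact: measurable_cst.
apply: measurable_funB => //.
exact: (measurableT_comp mG (measurable_shift _)).
Qed.

(** A lower limit exists at every point and is measurable before anything is known about the
    differentiability of [G]. *)
Definition drop_density G r : \bar R :=
  limn_einf (fun k => (drop_quotient G k r)%:E).

Lemma measurable_drop_density G : measurable_fun [set: R] G ->
  measurable_fun [set: R] (drop_density G).
Proof.
move=> mG; rewrite /drop_density /limn_einf.
apply: measurableT_comp => //; apply: measurable_fun_limn_esup => k.
by apply/measurable_EFinP/measurable_funN; exact: measurable_drop_quotient.
Qed.

Lemma cvg_Rintegral_drop_quotient G M a b : a <= b -> {homo G : r s /~ r <= s} ->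
  (forall r, `|G r| <= M) ->
  (forall t, t = a \/ t = b -> forall eps, 0 < eps -> exists2 d, 0 < d &
     forall r, t <= r < t + d -> `|G r - G t| <= eps) ->
  (\int[mu]_(r in `[a, b]) drop_quotient G k r) @[k --> \oo] --> G a - G b.
Proof.
move=> ab Gni bG cG.
have mN : measurable_fun [set: R] (fun r => - G r).
  by apply/measurable_funN; apply: nonincreasing_measurable => // r s; exact: Gni.
have bN r : `|- G r| <= M by rewrite normrN.
have cN t : t = a \/ t = b -> forall eps, 0 < eps -> exists2 d, 0 < d &
   forall r, t <= r < t + d -> `|- G r - - G t| <= eps.
  move=> /cG ct eps /ct[d d0 hd]; exists d => // r /hd.
  by rewrite -opprD normrN.
have := cvg_Rintegral_difference_quotient ab mN bN (cN a (or_introl erefl))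
  (cN b (or_intror erefl)).
rewrite opprK addrC => h; apply: cvg_trans h; apply: near_eq_cvg.
apply: nearW => k; apply: eq_Rintegral => r _.
by rewrite /drop_quotient opprK addrC.
Qed.

(* Fatou: the integrals of the difference quotients of [G] telescope. *)
Lemma integrable_drop_density G M a b : a <= b -> {homo G : r s /~ r <= s} ->
  (forall r, `|G r| <= M) ->
  (forall t, t = a \/ t = b -> forall eps, 0 < eps -> exists2 d, 0 < d &
     forall r, t <= r < t + d -> `|G r - G t| <= eps) ->
  mu.-integrable `[a, b] (drop_density G).
Proof.
move=> ab Gni bG cG.
have mG : measurable_fun [set: R] G by apply: nonincreasing_measurable => // r s; exact: Gni.
have dq0 k r : 0 <= drop_quotient G k r.
  by rewrite mulr_ge0// subr_ge0 Gni// lerDl invr_ge0.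
have mdq k := @measurable_drop_quotient G k mG.
have dd0 r : (0 <= drop_density G r)%E.
  rewrite /drop_density limn_einf_lim; apply: lime_ge; first exact: is_cvg_einfs.
  by apply: nearW => n; apply: le_ereal_inf_tmp => _ [k _ <-]; rewrite lee_fin.
apply/integrableP; split.
  by apply: measurable_funTS; exact: measurable_drop_density.
under eq_integral do rewrite gee0_abs//.
apply: le_lt_trans (fatou _ _ _ _) _ => //.
- by move=> n; apply/measurable_EFinP/measurable_funTS; exact: mdq.
- by move=> n x _; rewrite lee_fin.
have fin k : (\int[mu]_(r in `[a, b]) (drop_quotient G k r)%:E)%E =
    (\int[mu]_(r in `[a, b]) drop_quotient G k r)%:E.
  rewrite /Rintegral fineK//; apply: integrable_fin_num => //.
  apply: (@bounded_measurable_integrable _ _ (k.+1%:R * (M + M))) => //.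
    exact: lebesgue_measure_segment_lty.
  move=> r; rewrite normrM ger0_norm// ler_wpM2l//.
  by rewrite (le_trans (ler_normB _ _))// lerD.
have : ((\int[mu]_(r in `[a, b]) (drop_quotient G k r)%:E)%E @[k --> \oo]
    --> (G a - G b)%:E).
  under eq_fun do rewrite fin; apply/cvg_EFin; first exact: nearW.
  exact: cvg_Rintegral_drop_quotient bG cG.
by move=> /cvg_limn_einf_sup[-> _]; rewrite ltry.
Qed.

Lemma Rintegral_dominated_cvg (u : nat -> R -> R) (v w : R -> R) a b :
  (forall n, measurable_fun [set: R] (u n)) -> measurable_fun [set: R] v ->
  mu.-integrable `[a, b] (EFin \o w) ->
  {ae mu, forall r, a <= r <= b ->
     (u n r @[n --> \oo] --> v r) /\ forall n, `|u n r| <= w r} ->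
  (\int[mu]_(r in `[a, b]) u n r) @[n --> \oo] --> \int[mu]_(r in `[a, b]) v r.
Proof.
move=> mun mv iw hae; have aeF := ae_filter_ringOfSetsType mu.
have [||||iv _ lim] := @dominated_convergence _ _ _ mu `[a, b] ltac:(by [])
  (fun n r => (u n r)%:E) (EFin \o v) (EFin \o w) _ _ _ iw.
- by move=> n; apply/measurable_EFinP/measurable_funTS; exact: mun.
- by apply/measurable_EFinP/measurable_funTS; exact: mv.
- apply: filterS hae => r hr; rewrite /= in_itv/= => /hr[ur _].
  by apply/cvg_EFin => //; exact: nearW.
- by apply: filterS hae => r hr n; rewrite /= in_itv/= => /hr[_]; rewrite lee_fin.
rewrite /Rintegral; apply: fine_cvg; rewrite fineK//.
exact: integrable_fin_num.
Qed.

(** The open set [timespan T] is covered by its countably many subintervals with rational endpoints,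
    enumerated by [unpickle], so the exceptional sets add up to a null set. *)
Lemma ae_timespan T (P : R -> Prop) :
  (forall a b, timespan T a -> timespan T b -> a < b ->
    {ae mu, forall r, a < r < b -> P r}) ->
  {ae mu, forall r, timespan T r -> P r}.
Proof.
move=> h; have aeF := ae_filter_ringOfSetsType mu.
pose Q n r := if @unpickle (rat * rat)%type n is Some (p, q) then
  timespan T (ratr p) -> timespan T (ratr q) -> ratr p < r < ratr q -> P r else True.
have aeQ n : {ae mu, forall r, Q n r}.
  rewrite /Q; case: unpickle => [[p q]|]; last exact: aeW.
  have [Tp|nTp] := pselect (timespan T (ratr p : R)); last exact: aeW.
  have [Tq|nTq] := pselect (timespan T (ratr q : R)); last exact: aeW.
  have [pq|qp] := ltP (ratr p : R) (ratr q); last first.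
    by apply: aeW => r _ _ /andP[pr rq]; have := lt_trans pr rq; rewrite ltNge qp.
  by apply: filterS (h _ _ Tp Tq pq) => r hr _ _.
apply: filterS (ae_foralln aeQ) => r Qr Tr.
have [d d0 hd] := timespan_ball Tr.
have [|p] := @rat_in_itvoo R (r - d) r; first by rewrite ltrBlDr ltrDl.
rewrite in_itv/= => /andP[p1 p2].
have [|q] := @rat_in_itvoo R r (r + d); first by rewrite ltrDl.
rewrite in_itv/= => /andP[q1 q2].
have := Qr (pickle (p, q)); rewrite /Q pickleK; apply; last by rewrite p2.
  by apply: hd; rewrite ltr0_norm; lra.
by apply: hd; rewrite gtr0_norm; lra.
Qed.

End drop_quotient.

(** * Constant extension outside an interval *)

Section clamp.
Context {R : realType}.
Implicit Types a b r s : R.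

(** Composition with [clamp a b] extends a function on [[a, b]] by constants to the line; bounds and
    monotonicity then hold globally, and difference quotients make sense up to the endpoint. *)
Definition clamp a b r : R := Num.max a (Num.min r b).

Lemma clamp_bounds a b r : a <= b -> a <= clamp a b r <= b.
Proof. by move=> ab; rewrite le_max lexx ge_max ab ge_min lexx orbT. Qed.

Lemma clamp_id a b r : a <= r <= b -> clamp a b r = r.
Proof. by move=> /andP[ar rb]; rewrite /clamp (min_idPl rb) (max_idPr ar). Qed.

Lemma clamp_le a b r s : r <= s -> clamp a b r <= clamp a b s.
Proof.
move=> rs; rewrite ge_max !le_max lexx/=; apply/orP; right.
by rewrite le_min !ge_min rs lexx !orbT.
Qed.

Lemma clamp_dist a b r s : a <= b -> `|clamp a b r - clamp a b s| <= `|r - s|.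
Proof.
move=> ab; wlog rs : r s / r <= s.
  by move=> H; case: (leP r s) => [|/ltW] /H //; rewrite distrC [leRHS]distrC.
rewrite distrC [leRHS]distrC ger0_norm ?subr_ge0 ?clamp_le// ger0_norm ?subr_ge0//.
rewrite /clamp /Order.max /Order.min.
by case: (ltP r b) => ?; case: (ltP s b) => ?; case: ltP => ?; case: ltP => ?; lra.
Qed.

End clamp.

(** * The EVI in Dini form and the monotonicity of the energy *)

Section evi_curve.
Context {R : realType} {X : metricType R} (f : X -> \bar R) (K N : R)
  (T : \bar R) (y : R -> X).
Context (N_lt0 : N < 0) (f_lsc : lower_semicontinuous f)
  (y_EVI : EVI_gradient_curve K N f T y).

Local Notation I := (timespan T).
Local Notation q := (qKN K N).
Local Notation F z := (fine (fexpN N f z)).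
Local Notation g t := (fine (f (y t))).
Local Notation D s t := (mdist (y s) (y t)).

Lemma fy_fin t : I t -> f (y t) = (g t)%:E.
Proof. by case: y_EVI => yd _ _ /yd; rewrite /fdom/= => /fineK. Qed.

Lemma cy t : I t -> {for t, continuous y}.
Proof. by case: y_EVI => _ + _; exact. Qed.

Lemma y_star t : I t -> fdom_star f (y t).
Proof. by rewrite /fdom_star/= => /fy_fin ->; rewrite ltry. Qed.

Lemma fexpN_curve t : I t -> F (y t) = expR (g t / - N).
Proof. by move=> /fy_fin fyt; rewrite /fexpN fyt/= invrN mulrC. Qed.

Lemma fexpN_curve_gt0 t : I t -> 0 < F (y t).
Proof. by move=> /fexpN_curve ->; exact: expR_gt0. Qed.

Lemma fexpN_ge0 z : 0 <= F z.
Proof. exact/fine_ge0/expeR_ge0. Qed.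

(** Four times the EVI bounds the derivative of [q] of the distance by [2 * excess z t] minus [K]
    times that [q]. For finite [f z] the excess is f z - f (y t) to first order. *)
Definition excess z t : R := - N * (F z / F (y t) - 1).

Lemma continuous_q_mdist z t : I t ->
  {for t, continuous (fun s => q (mdist (y s) z))}.
Proof.
move=> /cy ct; apply: (@continuous_comp _ _ _ (fun s => mdist (y s) z) q).
  exact: continuous_mdistl.
exact: continuous_qKN.
Qed.

(** Passing from - K to |K| treats both signs of [K] alike; [eta] keeps the distance in the range
    where the EVI is available for [K < 0]. *)
Lemma evi_dini : exists2 eta, 0 < eta & forall z t,
  fdom_star f z -> I t -> mdist (y t) z < eta ->
  dini_le (fun s => q (mdist (y s) z)) t
    (2 * excess z t + `|K| * q (mdist (y t) z)).
Proof.
exists (if K < 0 then pi * Num.sqrt (N / K) else 1).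
  case: ifPn => // K0; rewrite mulr_gt0 ?pi_gt0// sqrtr_gt0.
  by rewrite nmulr_rgt0// invr_lt0.
move=> z t zs It yz; have [_ _ /(_ z t zs It)] := y_EVI.
have yz' : K < 0 -> mdist (y t) z < pi * Num.sqrt (N / K).
  by move: yz; case: ifP => //.
move=> /(_ yz')/= /upper_right_derivative_dini /(@dini_le_scale _ _ _ _ 4)h.
have := h ltac:(by []) => {}h; apply: dini_le_weaken h.
have qge0 := qKN_ge0 K N (mdist (y t) z).
have : - (K * q (mdist (y t) z)) <= `|K| * q (mdist (y t) z).
  by rewrite -mulNr ler_wpM2r// -normrN ler_norm.
rewrite /excess /qKN; lra.
Qed.

Lemma qKN_bounds : exists2 eta, 0 < eta & forall x, 0 <= x < eta ->
  x ^+ 2 / 2 <= q x <= 3 / 2 * x ^+ 2.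
Proof.
have [|eta eta0 h] := @qKN_increments R K N N_lt0 2^-1; first lra.
exists eta => // x /andP[x0 xeta].
have := h 0 x; rewrite lexx x0 => /(_ isT xeta).
by rewrite qKN0; lra.
Qed.

Lemma energy_lsc t c : I t -> c < g t ->
  exists2 d, 0 < d & forall r, `|r - t| < d -> I r /\ c < g r.
Proof.
move=> It; rewrite -lte_fin -fy_fin// => /f_lsc[V].
case/nbhs_ballP => e /= e0 Ve hV.
have [d d0 hd] := continuous_mdist (cy It) e0.
have [d' d'0 hd'] := timespan_ball It.
exists (Num.min d d') => [|r]; first by rewrite lt_min d0.
rewrite lt_min => /andP[rd rd']; have Ir := hd' _ rd'; split => //.
rewrite -lte_fin -fy_fin//; apply/hV/Ve.
by rewrite ballEmdist/= metric_sym; exact: hd.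
Qed.

Lemma ler_fexpN_curve s t : I s -> I t -> (F (y s) <= F (y t)) = (g s <= g t).
Proof.
move=> Is It; rewrite (fexpN_curve Is) (fexpN_curve It) ler_expR.
by rewrite ler_pM2r// invr_gt0 oppr_gt0.
Qed.

(** With [x = (g s - g t) / - N] the excess is [- N * (expR x - 1)]; this lemma and the next are the
    two sides of [x <= expR x - 1 <= expR x * x]. *)
Lemma ge_excess s t : I s -> I t -> g s - g t <= excess (y s) t.
Proof.
move=> Is It; rewrite /excess !fexpN_curve// -expRN -expRD -mulNr -mulrDl.
have n0 : 0 < - N by rewrite oppr_gt0.
rewrite -ler_pdivrMl// mulrC.
have := expR_ge1Dx ((g s - g t) / - N); lra.
Qed.

Lemma le_excess s t : I s -> I t -> g t <= g s ->
  excess (y s) t <= expR ((g s - g t) / - N) * (g s - g t).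
Proof.
move=> Is It gts; rewrite /excess !fexpN_curve// -expRN -expRD -mulNr -mulrDl.
have n0 : 0 < - N by rewrite oppr_gt0.
set x := (_ / _); have -> : g s - g t = - N * x by rewrite /x; field; lra.
rewrite mulrCA ler_pM2l//.
have : expR x * (1 + - x) <= expR x * expR (- x).
  by rewrite ler_pM2l ?expR_gt0// expR_ge1Dx.
rewrite -expRD subrr expR0; lra.
Qed.

Lemma excess_le0 s t : I s -> I t -> (excess (y s) t <= 0) = (g s <= g t).
Proof.
move=> Is It; rewrite /excess pmulr_rle0 ?oppr_gt0// subr_le0.
by rewrite ler_pdivrMr ?fexpN_curve_gt0// mul1r ler_fexpN_curve.
Qed.

Lemma excess_lt0 s t : I s -> I t -> (excess (y s) t < 0) = (g s < g t).
Proof.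
move=> Is It; rewrite /excess pmulr_rlt0 ?oppr_gt0// subr_lt0.
by rewrite ltr_pdivrMr ?fexpN_curve_gt0// mul1r ltNge ler_fexpN_curve// -ltNge.
Qed.

(* If [g s < g t], let [u] be the last time in [s, t] with [g u <= g s]. The EVI
   with [z = y u] makes [y] stay at [y u] right after [u], where [g] exceeds [g u]:
   this contradicts the strict sign of the excess. *)
Lemma energy_nonincreasing s t : I s -> I t -> s <= t -> g t <= g s.
Proof.
move=> Is It st; rewrite leNgt; apply/negP => gst.
have Ist r : s <= r <= t -> I r by exact: timespan_convex.
pose S := [set r | s <= r <= t /\ g r <= g s].
have Ss : S s by split; rewrite ?lexx.
have supS : has_sup S by split; [exists s|exists t => r [/andP[]]].
pose u := sup S.
have su : s <= u by apply: ub_le_sup => //; case: supS.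
have ut : u <= t by apply: ge_sup => [|r [/andP[]]]//; exists s.
have Iu : I u by apply: Ist; rewrite su.
have gu : g u <= g s.
  rewrite leNgt; apply/negP => /(energy_lsc Iu)[d d0 hd].
  have udS : u - d < sup S by rewrite -/u; lra.
  have [r [/andP[sr rt] gr] ur] := sup_gt (proj1 supS) udS.
  have ru : r <= u by apply: ub_le_sup; [case: supS|split=> //; rewrite sr].
  have [|_] := hd r; first by rewrite ler0_norm; lra.
  by rewrite ltNge gr.
have utlt : u < t by rewrite lt_neqAle ut andbT; apply: contraTneq gst => <-; rewrite -leNgt.
have after r : u < r <= t -> g s < g r.
  move=> /andP[ur rt]; rewrite ltNge; apply/negP => gr.
  have : r <= u by apply: ub_le_sup; [case: supS|split=> //; rewrite rt andbT; lra].
  by lra.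
have [eta eta0 hE] := evi_dini; have [eta' eta'0 hq] := qKN_bounds.
have [d d0 hd] := continuous_mdist (cy Iu) eta0.
have [d' d'0 hd'] := continuous_mdist (cy Iu) eta'0.
pose L := `|K|.
(* So close to [u] that the EVI applies with [z = y u], and that [L * (w - u) <= 2^-1] as
   [dini_gronwall] requires. *)
pose w := Num.min t (u + Num.min (Num.min d d') (2 * (L + 1))^-1 / 2).
have L0 : 0 <= L by rewrite /L normr_ge0.
have m0 : 0 < Num.min (Num.min d d') (2 * (L + 1))^-1.
  by rewrite !lt_min d0 d'0/= invr_gt0; lra.
have uw : u < w by rewrite lt_min utlt/=; lra.
have wt : w <= t by rewrite ge_min lexx.
have [wd wd' wL] : [/\ w - u < d, w - u < d' & (w - u) * (2 * (L + 1)) < 1].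
  have : w <= u + Num.min (Num.min d d') (2 * (L + 1))^-1 / 2.
    by rewrite ge_min lexx orbT.
  have : Num.min (Num.min d d') (2 * (L + 1))^-1 <= d by rewrite !ge_min lexx.
  have : Num.min (Num.min d d') (2 * (L + 1))^-1 <= d' by rewrite !ge_min lexx orbT.
  have : Num.min (Num.min d d') (2 * (L + 1))^-1 <= (2 * (L + 1))^-1.
    by rewrite !ge_min lexx orbT.
  by move=> *; split; [lra|lra|rewrite -ltr_pdivlMr ?div1r; lra].
have Iuw r : u <= r <= w -> I r by move=> ?; apply: Ist; lra.
have Dr r : u <= r <= w -> D r u < eta.
  by move=> ?; apply: hd; rewrite ger0_norm; lra.
have exc r : u <= r <= w -> excess (y u) r <= 0.
  move=> urw; rewrite excess_le0//; last exact: Iuw.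
  have [->//|ur] := eqVneq r u; apply: (le_trans gu); apply/ltW/after.
  by lra.
have v0 r : u <= r <= w -> q (D r u) = 0.
  move=> urw; apply/eqP; rewrite eq_le qKN_ge0 andbT.
  have := @dini_gronwall R (fun r => q (D r u)) u r L 0.
  rewrite mulr0 mul0r; apply; rewrite ?mdistxx ?qKN0//; try lra.
  - by nra.
  - by move=> x _; exact: qKN_ge0.
  - by move=> x xr; apply/continuous_q_mdist/Iuw; lra.
  move=> x xr; have := hE (y u) x (y_star Iu) (Iuw x ltac:(lra)) (Dr x ltac:(lra)).
  by apply: dini_le_weaken; have := exc x ltac:(lra); rewrite /L; lra.
clear hq hd hd' wd wd' wL m0 L0 d0 d'0.
pose m := (u + w) / 2.
have um : u < m < w by rewrite /m; lra.
have Im : I m by apply: Iuw; lra.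
have := hE _ m (y_star Iu) Im (Dr m ltac:(lra)).
rewrite v0 ?mulr0 ?addr0; last lra.
have exm : excess (y u) m < 0.
  by rewrite excess_lt0//; apply/(le_lt_trans gu)/after; lra.
move=> /(_ (- (excess (y u) m)))[|e e0 he]; first by rewrite oppr_gt0.
pose e' := Num.min (e / 2) ((w - m) / 2).
have e'0 : 0 < e' by rewrite lt_min; lra.
have e'e : e' <= e / 2 by rewrite ge_min lexx.
have e'w : e' <= (w - m) / 2 by rewrite ge_min lexx orbT.
have := he e' ltac:(lra); rewrite !v0; [|lra|lra].
have : excess (y u) m * e' < 0 by rewrite pmulr_llt0.
lra.
Qed.

(** Gronwall for [q (D r s)] on [[s, t]]: as the energy decreases, the excess at [r] is at most the
    excess at [t], itself at most [M * (g s - g t)]. In the constant [8 * M] a factor 4 comes from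
    Gronwall and a factor 2 from [x ^+ 2 <= 2 * q x]. *)
Lemma dist_sqr_le a b : I a -> I b -> exists C d, [/\ 0 < C, 0 < d &
  forall s t, a <= s -> s <= t -> t <= b -> t - s < d ->
    D s t ^+ 2 <= C * (t - s) * (g s - g t)].
Proof.
move=> Ia Ib; have [ab|ba] := leP a b; last first.
  by exists 1, 1; split => // s t *; exfalso; lra.
have Iab r : a <= r <= b -> I r by exact: timespan_convex.
have [eta eta0 hE] := evi_dini; have [eta' eta'0 hq] := qKN_bounds.
have m0 : 0 < Num.min eta eta' by rewrite lt_min eta0.
have [|d d0 hd] := @curve_uniform_continuity R X y a b _ _ m0.
  by move=> r /Iab; exact: cy.
pose L := `|K|; have L0 : 0 <= L by rewrite /L normr_ge0.
pose M := expR ((g a - g b) / - N).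
have M0 : 0 < M by exact: expR_gt0.
exists (8 * M), (Num.min d (2 * (L + 1))^-1); split; first by rewrite mulr_gt0.
  by rewrite lt_min d0 invr_gt0; lra.
move=> s t as_ st tb; rewrite lt_min => /andP[tsd tsL].
have [Is It] : I s /\ I t by split; apply: Iab; lra.
have gts := energy_nonincreasing Is It st.
have tsL' : (t - s) * (2 * (L + 1)) < 1 by rewrite -ltr_pdivlMr ?div1r//; lra.
have Dr r : s <= r <= t -> D r s < Num.min eta eta'.
  by move=> ?; apply: hd; [lra|lra|rewrite ger0_norm; lra].
have excM : excess (y s) t <= M * (g s - g t).
  apply: (le_trans (le_excess Is It gts)); rewrite ler_wpM2r ?subr_ge0//.
  rewrite ler_expR ler_pM2r ?invr_gt0 ?oppr_gt0// lerB//.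
    by apply: energy_nonincreasing => //; lra.
  by apply: energy_nonincreasing.
have exc0 : 0 <= excess (y s) t by have := ge_excess Is It; lra.
have := @dini_gronwall R (fun r => q (D r s)) s t L (2 * excess (y s) t).
rewrite mdistxx qKN0.
have H1 : L * (t - s) <= 2^-1 by nra.
move=> /(_ st L0 H1)/= hG.
have {hG} : q (D t s) <= 2 * (2 * excess (y s) t) * (t - s).
  apply: hG => //; [lra|by move=> r _; exact: qKN_ge0| |].
    by move=> r sr; apply/continuous_q_mdist/Iab; lra.
  move=> r sr; have Ir : I r by apply: Iab; lra.
  have Drs := Dr r ltac:(lra); rewrite lt_min in Drs; case/andP: Drs => Drs _.
  have := hE (y s) r (y_star Is) Ir Drs.
  apply: dini_le_weaken; rewrite /L addrC lerD2l ler_pM2l//.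
  rewrite /excess ler_pM2l ?oppr_gt0// lerB// ler_wpM2l ?fexpN_ge0//.
  rewrite lef_pV2 ?posrE ?fexpN_curve_gt0// ler_fexpN_curve//.
  by apply: energy_nonincreasing => //; lra.
have /hq : 0 <= D t s < eta'.
  have := Dr t ltac:(lra); rewrite lt_min => /andP[_ ->].
  by rewrite mdist_ge0.
rewrite (metric_sym (y t)) => /andP[lo _] hi.
have ts0 : 0 <= t - s by lra.
have : excess (y s) t * (t - s) <= M * (g s - g t) * (t - s) by rewrite ler_wpM2r.
lra.
Qed.

(** * Right metric speed, slope bound and growth of the curve *)

(* The lower right metric speed of [y] at [t] is at most [p]. *)
Definition speed_le t p : Prop := forall eps, 0 < eps -> forall d, 0 < d ->
  exists2 e, 0 < e < d & D (t + e) t <= (p + eps) * e.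

(** In a short time [e] along which [y] moves by about [p * e], [q] of the distance [x] to [z] drops
    by at most about [2 * x * p * e], while the EVI bounds its growth by [2 * excess z t * e] and a
    term in [K]. The radius [eta] depends neither on [t] nor on [p]. *)
Lemma slope_estimate eps : 0 < eps < 1 -> exists2 eta, 0 < eta &
  forall t p z, I t -> 0 <= p -> speed_le t p -> fdom_star f z ->
    mdist (y t) z < eta ->
    - excess z t <= (1 + eps) * (p * mdist (y t) z + `|K| * mdist (y t) z ^+ 2).
Proof.
move=> eps01; have [eta eta0 hE] := evi_dini.
have [eta' eta'0 hq] := qKN_increments K N_lt0 eps01.
exists (Num.min eta eta'); first by rewrite lt_min eta0.
move=> t p z It p0 tp zs; rewrite lt_min; set x := mdist (y t) z => /andP[xeta xeta'].
have x0 : 0 <= x by exact: mdist_ge0.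
have hx := hE z t zs It xeta.
apply/ler_addgt0Pr => e0 e00.
(* The error [e0 / c] occurs once in the Dini bound and, multiplied by [2 * (1 + eps) * x], in the
   speed bound; the two together stay below [e0]. *)
pose c := 2 * (1 + (1 + eps) * x).
have c0 : 0 < c by rewrite mulr_gt0// ltr_pwDl// mulr_ge0//; lra.
have ec0 : 0 < e0 / c by rewrite divr_gt0.
have [d d0 hd] := hx _ ec0.
have [|d' d'0 hd'] := continuous_mdist (cy It) (eps := eta' - x); first by rewrite subr_gt0.
have [|e /andP[e_gt0 ed] De] := tp _ ec0 (Num.min d d'); first by rewrite lt_min d0.
move: ed; rewrite lt_min => /andP[ed ed'].
have := hd e ltac:(by rewrite e_gt0); rewrite -/x.
set x' := mdist (y (t + e)) z.
have x'0 : 0 <= x' by exact: mdist_ge0.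
have xx' : `|x' - x| <= D (t + e) t by exact: mdist_dist.
have x'eta' : x' < eta'.
  have : D (t + e) t < eta' - x by apply: hd'; rewrite addrAC subrr add0r gtr0_norm.
  by move: xx'; rewrite ler_norml; lra.
have drop : - (2 * (1 + eps) * x * D (t + e) t) <= q x' - q x.
  have [x'x|x'x] := leP x' x.
    have := hq x' x; rewrite x'0 x'x => /(_ isT xeta') /andP[_ h].
    have : x ^+ 2 - x' ^+ 2 <= 2 * x * D (t + e) t.
      have -> : x ^+ 2 - x' ^+ 2 = (x + x') * (x - x') by ring.
      by rewrite ler_pM//; move: xx'; rewrite ler_norml; lra.
    rewrite -(ler_pM2l (_ : 0 < 1 + eps)); lra.
  have := hq x x'; rewrite x0 (ltW x'x) => /(_ isT x'eta') /andP[h _].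
  have : 0 <= (1 - eps) * (x' ^+ 2 - x ^+ 2).
    rewrite mulr_ge0 ?subr_ge0//; first lra.
    by rewrite lerXn2r ?nnegrE// ltW.
  have : 0 <= 2 * (1 + eps) * x * D (t + e) t.
    by rewrite !mulr_ge0 ?mdist_ge0//; lra.
  lra.
move=> up.
have qx : q x <= (1 + eps) * x ^+ 2.
  have := hq 0 x; rewrite lexx x0 => /(_ isT xeta').
  by rewrite qKN0 expr0n/= !subr0 => /andP[].
have Kqx : `|K| * q x <= `|K| * ((1 + eps) * x ^+ 2) by rewrite ler_wpM2l.
have : - (2 * (1 + eps) * x * ((p + e0 / c) * e)) <=
    (2 * excess z t + `|K| * q x + e0 / c) * e.
  apply: le_trans up; apply: le_trans drop.
  by rewrite lerN2 ler_wpM2l// !mulr_ge0//; lra.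
rewrite mulrA -mulNr ler_pM2r//.
have ecE : e0 / c * c = e0 by rewrite mulfVK// gt_eqF.
have : 0 <= `|K| * ((1 + eps) * x ^+ 2) by rewrite !mulr_ge0// ?sqr_ge0//; lra.
by move: ecE ec0; rewrite /c; move: (e0 / _) => u ecE u0; lra.
Qed.

(** The EVI at a later time [r] with [z = y t] involves [excess (y t) r], whereas the slope bound at
    [t] controls [- excess (y r) t]; the exchange costs a ratio of values of [F]. *)
Lemma excess_swap s t : I s -> I t ->
  excess (y s) t = F (y s) / F (y t) * - excess (y t) s.
Proof.
move=> Is It; have Fs := fexpN_curve_gt0 Is; have Ft := fexpN_curve_gt0 It.
by rewrite /excess; field; rewrite !gt_eqF.
Qed.

(* Along [r |-> D r t] the EVI with [z = y t] and the slope bound at [t] give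
   [D' <= theta * p + C * D], so that [D] grows at most like [theta * p]. *)
Lemma growth_estimate theta eps : 1 <= theta -> 0 < eps < 3^-1 ->
  exists eta d, [/\ 0 < eta, 0 < d & forall t h p,
    I t -> I (t + h) -> 0 <= h < d -> 0 <= p -> speed_le t p ->
    (forall r, t <= r <= t + h -> D r t < eta) ->
    F (y t) <= theta * F (y (t + h)) ->
    D (t + h) t <= theta * (1 + 9 * eps) * p * h /\
    excess (y t) (t + h) <= theta ^+ 2 * (1 + 9 * eps) ^+ 2 * p ^+ 2 * h].
Proof.
move=> th1 eps13; have eps01 : 0 < eps < 1 by lra.
have eps1 : eps <= 1 by lra.
have [eta1 eta10 hE] := evi_dini.
have [eta2 eta20 hq] := qKN_increments K N_lt0 eps01.
have [eta3 eta30 hS] := slope_estimate eps01.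
have L0 : 0 <= `|K| by exact: normr_ge0.
have tL0 : 0 <= theta * `|K| by rewrite mulr_ge0//; lra.
(* The time bound yields 6 theta |K| h <= eps, as the arithmetic lemmas ask. *)
exists (Num.min (Num.min eta1 eta2) eta3), (eps / (6 * (theta * `|K|) + 1)); split.
- by rewrite !lt_min eta10 eta20.
- by rewrite divr_gt0//; lra.
move=> t h p It Ith /andP[h0]; rewrite ltr_pdivlMr; last by lra.
move=> hd p0 tp Dr hF.
have tr r : t <= r <= t + h -> I r by exact: timespan_convex.
have Kh : 6 * (theta * `|K| * h) <= eps by lra.
have exr r : t <= r <= t + h ->
    excess (y t) r <= theta * ((1 + eps) * (p * D r t + `|K| * D r t ^+ 2)).
  move=> trh; have Ir := tr _ trh; rewrite excess_swap//.
  have := Dr r trh; rewrite !lt_min (metric_sym (y r)) => /andP[_ Dr3].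
  have := hS t p (y r) It p0 tp (y_star Ir) Dr3.
  have : 0 <= - excess (y r) t.
    by rewrite oppr_ge0 excess_le0//; apply: energy_nonincreasing => //; lra.
  rewrite (metric_sym (y t)) => e0 e1; apply: ler_pM => //.
    by rewrite divr_ge0// fexpN_ge0.
  rewrite ler_pdivrMr ?fexpN_curve_gt0//; apply: le_trans hF _.
  rewrite ler_wpM2l; [|lra|]; first lra.
  by rewrite ler_fexpN_curve//; apply: energy_nonincreasing => //; lra.
(* A separate positive slope [c] is used since [p] may be 0; it is lowered to
   [theta * (1 + 9 * eps) * p] afterwards. *)
have main c : theta * (1 + 9 * eps) * p <= c -> 0 < c -> D (t + h) t <= c * h.
  move=> cp c0; move: h0; rewrite le_eqVlt => /predU1P[<-|h0].
    by rewrite addr0 mdistxx mulr0.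
  apply/ler_addgt0Pl => e0 e00.
  (* The line starts at a height [k > 0], so that [D r t] is positive where it touches the line, as
     [dini_sqr] requires; [k <= c * h] keeps it below [2 * (c * h)] there. *)
  pose k := Num.min e0 (c * h).
  have k0 : 0 < k by rewrite lt_min e00 mulr_gt0.
  have ke0 : k <= e0 by rewrite ge_min lexx.
  have kch : k <= c * h by rewrite ge_min lexx orbT.
  suff : D (t + h) t <= k + c * (t + h - t) by rewrite addrAC subrr add0r; lra.
  apply: (@dini_comparison R (fun r => D r t)); first by lra.
  - by move=> r /tr/cy; exact: continuous_mdistl.
  - by rewrite mdistxx ltW.
  move=> r rh; set x := D r t => xE.
  have trh : t <= r <= t + h by lra.
  have x0 : 0 < x by rewrite xE ltr_wpDr// mulr_ge0//; lra.
  have x2 : x <= 2 * (c * h).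
    have : c * (r - t) <= c * h by rewrite ler_pM2l//; lra.
    by rewrite xE; lra.
  pose w := theta * (1 + eps) * (p + `|K| * x) + `|K| * x.
  have w0 : 0 <= w.
    by rewrite /w !(addr_ge0, mulr_ge0)//; lra.
  exists (w / (1 - eps)).
    rewrite ltr_pdivrMr; last by lra.
    by apply: (@growth_rate_lt _ _ _ _ h) => //; [exact: ltW|rewrite (ltW x0)].
  have Ir := tr _ trh; have := Dr r trh; rewrite !lt_min -/x.
  case/andP=> /andP[xeta1 xeta2] _.
  apply: (dini_sqr eps01 w0) (hE (y t) r (y_star It) Ir xeta1) _.
  - by move=> a b ab /(hq a b ab)/andP[].
  - exact/continuous_mdistl/cy.
  - by rewrite -/x x0.
  have := hq 0 x; rewrite lexx (ltW x0) => /(_ isT xeta2) /andP[_].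
  rewrite -/x qKN0 expr0n/= !subr0 => /(ler_wpM2l L0) Kq.
  have Keps : `|K| * x ^+ 2 * eps <= `|K| * x ^+ 2.
    by rewrite ler_piMr// mulr_ge0// sqr_ge0.
  have := exr r trh; rewrite -/x /w; move: Kq Keps; clear; lra.
have Dh : D (t + h) t <= theta * (1 + 9 * eps) * p * h.
  apply/ler_addgt0Pr => e0 e00.
  have P0 : 0 <= theta * (1 + 9 * eps) * p by rewrite !mulr_ge0//; lra.
  have := main (theta * (1 + 9 * eps) * p + e0 / (h + 1)).
  have e0h : 0 < e0 / (h + 1) by rewrite divr_gt0//; lra.
  rewrite lerDl (ltW e0h) ltr_wpDl// => /(_ isT isT) /le_trans; apply.
  rewrite mulrDl lerD2l -mulrA ler_piMr ?(ltW e00)// mulrC ler_pdivrMr; lra.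
split => //.
have x0 : 0 <= D (t + h) t by exact: mdist_ge0.
apply: le_trans (exr _ _) _; first by lra.
by apply: growth_excess_le => //; rewrite x0.
Qed.

(** Serves as the domination in the convergence theorems. On [[a, b]] every ratio
    [F (y t) / F (y (t + h))] is at most [theta], and [eps = 4^-1] makes [(1 + 9 * eps) ^+ 2]
    smaller than 16. *)
Lemma growth_uniform a b : I a -> I b -> exists C d, [/\ 0 < C, 0 < d &
  forall t h p, a <= t -> 0 <= h < d -> t + h <= b -> 0 <= p -> speed_le t p ->
    D (t + h) t <= C * p * h /\ g t - g (t + h) <= C * p ^+ 2 * h].
Proof.
move=> Ia Ib; have [ab|ba] := leP a b; last first.
  by exists 1, 1; split => // t h *; exfalso; lra.
have Iab r : a <= r <= b -> I r by exact: timespan_convex.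
pose theta := Num.max 1 (F (y a) / F (y b)).
have th1 : 1 <= theta by rewrite le_max lexx.
have [|eta [d [eta0 d0 hgr]]] := @growth_estimate theta 4^-1 th1; first by lra.
have [|d' d'0 hd'] := @curve_uniform_continuity R X y a b _ _ eta0.
  by move=> r /Iab; exact: cy.
exists (16 * theta ^+ 2), (Num.min d d'); split.
- by rewrite mulr_gt0// exprn_gt0; lra.
- by rewrite lt_min d0.
move=> t h p at_ /andP[h0]; rewrite lt_min => /andP[hd hdd'] thb p0 tp.
have It : I t by apply: Iab; lra.
have Ith : I (t + h) by apply: Iab; lra.
have [|||hD hex] := hgr t h p It Ith _ p0 tp; first by rewrite h0.
- by move=> r ?; apply: hd'; [lra|lra|rewrite ger0_norm; lra].
- apply: (@le_trans _ _ (F (y a))).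
    by rewrite ler_fexpN_curve//; apply: energy_nonincreasing => //; lra.
  apply: (@le_trans _ _ (theta * F (y b))).
    rewrite -ler_pdivrMr ?fexpN_curve_gt0//.
    by rewrite /theta le_max lexx orbT.
  rewrite ler_pM2l; last by lra.
  by rewrite ler_fexpN_curve//; apply: energy_nonincreasing.
have th0 : 0 <= theta by lra.
have thth : theta <= theta ^+ 2 by rewrite ler_eXnr.
split.
  apply: (le_trans hD); do 2 rewrite ler_wpM2r//.
  lra.
apply: le_trans (ge_excess It Ith) _; apply: (le_trans hex).
do 2 rewrite ler_wpM2r ?sqr_ge0//.
by rewrite mulrC ler_wpM2r ?sqr_ge0//; lra.
Qed.

(** Lower semicontinuity keeps [g (t + h)] above [g t - - N * ln (1 + e)] for small [h], which is
    the condition of [growth_estimate] with [theta = 1 + e]; so no constant is lost in the limit. *)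
Lemma growth_sharp t p eps : I t -> 0 <= p -> speed_le t p -> 0 < eps ->
  exists2 d, 0 < d & forall h, 0 < h < d -> [/\ I (t + h),
    D (t + h) t <= (1 + eps) * p * h & g t - g (t + h) <= (1 + eps) * p ^+ 2 * h].
Proof.
move=> It p0 tp eps0.
(* Small enough for [(1 + e) ^+ 2 * (1 + 9 * e) ^+ 2 <= 1 + eps]. *)
pose e := Num.min eps 1 / 60.
have e0 : 0 < e by rewrite divr_gt0// lt_min eps0/=.
have e60 : e <= 60^-1.
  by rewrite /e ler_pdivrMr// mulVf// ge_min lexx orbT.
have ee : 60 * e <= eps by rewrite /e mulrC mulfVK// ge_min lexx.
have th1 : 1 <= 1 + e by lra.
have [|eta [d [eta0 d0 hgr]]] := @growth_estimate (1 + e) e th1; first by lra.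
have [d1 d10 hd1] := continuous_mdist (cy It) eta0.
have lnth : 0 < ln (1 + e) by rewrite ln_gt0//; lra.
have [|d2 d20 hd2] := @energy_lsc t (g t - - N * ln (1 + e)) It.
  by rewrite ltrBlDr ltrDl mulr_gt0 ?oppr_gt0.
exists (Num.min d (Num.min d1 d2)) => [|h /andP[h0]]; first by rewrite !lt_min d0 d10.
rewrite !lt_min => /andP[hd /andP[hdd1 hdd2]].
have [|Ith gth] := hd2 (t + h); first by rewrite addrAC subrr add0r gtr0_norm.
have [|||hD hex] := hgr t h p It Ith _ p0 tp; first by rewrite ltW.
- by move=> r ?; apply: hd1; rewrite ger0_norm; lra.
- rewrite !fexpN_curve// -[in leRHS](lnK (_ : 1 + e \is Num.pos)); last first.
    by rewrite posrE; lra.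
  rewrite -expRD ler_expR ler_pdivrMr ?oppr_gt0// mulrDl mulfVK; last first.
    by rewrite oppr_eq0 lt_eqF.
  by move: gth; lra.
have c1 : (1 + e) * (1 + 9 * e) <= 1 + eps by nra.
have c2 : (1 + e) ^+ 2 * (1 + 9 * e) ^+ 2 <= 1 + eps.
  rewrite -exprMn.
  have u1 : (1 + e) * (1 + 9 * e) <= 1 + 11 * e by nra.
  have u0 : 0 <= (1 + e) * (1 + 9 * e) by rewrite mulr_ge0; lra.
  have : ((1 + e) * (1 + 9 * e)) ^+ 2 <= (1 + 11 * e) ^+ 2.
    by rewrite lerXn2r ?nnegrE//; lra.
  by nra.
split => //.
  by apply: (le_trans hD); rewrite !ler_wpM2r// ltW.
apply: le_trans (ge_excess It Ith) _; apply: (le_trans hex).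
by rewrite !ler_wpM2r ?sqr_ge0// ltW.
Qed.

(** The upper bound is asked only along arbitrarily small times; [growth_sharp] upgrades it to all
    small times, so that [p] is a genuine right limit of the metric quotient. *)
Definition speed t p : Prop := speed_le t p /\
  forall eps, 0 < eps -> exists2 d, 0 < d &
    forall e, 0 < e < d -> (p - eps) * e <= D (t + e) t.

Lemma speed_exists t P : 0 <= P -> speed_le t P -> exists2 p, 0 <= p & speed t p.
Proof.
move=> P0 tP; pose S := [set p | 0 <= p /\ speed_le t p].
have SP : S P by [].
have lS : has_lbound S by exists 0 => p [].
have infS : has_inf S by split; [exists P|].
have p0 : 0 <= inf S by apply: lb_le_inf; [exists P|move=> p []].
exists (inf S) => //; split=> [eps eps0 d d0|eps eps0].
  have eps2 : 0 < eps / 2 by rewrite divr_gt0.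
  have [p [_ hp] pS] := inf_adherent eps2 infS.
  have [e ed De] := hp _ eps2 _ d0; exists e => //.
  by apply: (le_trans De); rewrite ler_pM2r; lra.
apply: contrapT => hn.
(* A nonnegative [inf S - eps] that failed as a lower bound would itself belong to [S]; a negative
   one is trivially a lower bound. *)
have [neg|pos] := ltP (inf S - eps) 0.
  apply: hn; exists 1 => // e /andP[e0 _].
  apply: (@le_trans _ _ 0); last exact: mdist_ge0.
  by rewrite nmulr_rle0 ?ltW.
have : S (inf S - eps).
  split=> // eps' eps'0 d d0; apply: contrapT => hn'; apply: hn; exists d => // e ed.
  rewrite leNgt; apply/negP => De; apply: hn'; exists e => //.
  by apply: (le_trans (ltW De)); rewrite ler_pM2r; lra.
by move=> /(ge_inf lS); lra.
Qed.

(* The EVI with [z = y t] is integrated only over the last [tau * h] of the time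
   interval [t, t + h]; letting [tau] tend to 0 removes the factor 2 that the
   crude bound [excess (y t) r <= excess (y t) (t + h)] would cost. *)
Lemma energy_drop_ge t p eps : I t -> 0 <= p -> speed t p -> 0 < eps < 1 ->
  exists2 d, 0 < d & forall h, 0 < h < d ->
    (1 - eps) * p ^+ 2 * h <= g t - g (t + h).
Proof.
move=> It p0 [tp tp'] eps01.
have within (h d r : R) : 0 < r <= h -> h < d -> 0 < r < d by lra.
have shift (h d r : R) : 0 <= r <= h -> h < d -> `|t + r - t| < d.
  by move=> ? ?; rewrite addrAC subrr add0r ger0_norm; lra.
have le_addr (r : R) : 0 <= r -> t <= t + r by lra.
have [d0 d00 hd0] := timespan_ball It.
(* For [p = 0] the tolerance [e * p] used below would vanish, and the claim is plain
   monotonicity. *)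
have [p_0|p_0] := eqVneq p 0.
  exists d0 => // h h0; rewrite p_0 expr0n/= mulr0 mul0r subr_ge0.
  have [/ltW h0' hd] := andP h0.
  have Ith : I (t + h) by apply/hd0/(shift h); rewrite ?h0' ?lexx.
  by apply: energy_nonincreasing => //; exact: le_addr.
have {p_0}pgt0 : 0 < p by rewrite lt_neqAle eq_sym p_0.
(* The factor [1 - 2 * tau] of [two_stage_arithmetic] becomes [1 - eps]; [e] is the tolerance of
   that lemma. *)
pose tau := eps / 2; have tau01 : 0 < tau < 1 by rewrite /tau; lra.
pose e := tau ^+ 2 / 10.
have e0 : 0 < e by rewrite divr_gt0// exprn_gt0; lra.
have e1 : e < 10^-1.
  have : tau ^+ 2 < 1 by rewrite expr2 mulr_ilt1//; lra.
  by rewrite /e; lra.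
have e01 : 0 < e < 1 by lra.
have [eta1 eta10 hE] := evi_dini.
have [eta2 eta20 hq] := qKN_increments K N_lt0 e01.
have m0 : 0 < Num.min eta1 eta2 by rewrite lt_min eta10.
have [d1 d10 hd1] := continuous_mdist (cy It) m0.
have [|d2 d20 hd2] := tp' (e * p); first by rewrite mulr_gt0.
have [d3 d30 hd3] := growth_sharp It p0 tp e0.
have lnth : 0 < ln (1 + e) by rewrite ln_gt0//; lra.
have [|d4 d40 hd4] := @energy_lsc t (g t - - N * ln (1 + e)) It.
  by rewrite ltrBlDr ltrDl mulr_gt0 ?oppr_gt0.
have K1 : 0 < 8 * `|K| + 1 by have := normr_ge0 K; lra.
(* Below this time the [K] term of the EVI, integrated over the last [tau * h], is at most
   [tau ^+ 2 * (p * h) ^+ 2]. *)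
pose d5 := tau / (8 * `|K| + 1).
have d50 : 0 < d5 by rewrite divr_gt0//; lra.
exists (Num.min (Num.min (Num.min d0 d1) (Num.min d2 d3)) (Num.min d4 d5)).
  by rewrite !lt_min d00 d10 d20 d30 d40.
move=> h /andP[h0]; rewrite !lt_min -!andbA => /and5P[hh0 hh1 hh2 hh3 /andP[hh4]].
rewrite ltr_pdivlMr// => hh5.
have {}tp' (r : R) : 0 < r <= h -> (1 - e) * p * r <= D (t + r) t.
  move=> /within /(_ hh2) /hd2; apply: le_trans.
  by rewrite mulrBl mul1r mulrBl ?mulrA.
have {}tp (r : R) : 0 < r <= h -> D (t + r) t <= (1 + e) * p * r.
  by move=> /within /(_ hh3) /hd3[].
have Itr (r : R) : 0 <= r <= h -> I (t + r).
  by move=> /shift /(_ hh0); exact: hd0.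
have hh : 0 <= h <= h by rewrite lexx ltW.
have Ith : I (t + h) by exact: Itr.
have gth : g (t + h) <= g t.
  by apply: energy_nonincreasing => //; exact/le_addr/ltW.
set G := g t - g (t + h).
have exG : excess (y t) (t + h) <= (1 + e) * G.
  apply: (le_trans (le_excess It Ith gth)); rewrite ler_wpM2r ?subr_ge0//.
  have [|_ hG] := hd4 (t + h); first exact: shift hh hh4.
  rewrite -[leRHS](lnK (_ : 1 + e \is Num.pos)); last first.
    by rewrite posrE ltr_pDl// ltW.
  by rewrite ler_expR ler_pdivrMr ?oppr_gt0// mulrC lerBlDl -lerBlDr ltW.
have Dr (r : R) : 0 <= r <= h -> D (t + r) t < Num.min eta1 eta2.
  by move=> /shift /(_ hh1); exact: hd1.
clear hd0 hd1 hd2 hd3 hd4 hh0 hh1 hh2 hh3 hh4 d00 d10 d20 d30 d40 d50 m0 lnth K1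
  within shift.
have qD (r : R) : 0 < r <= h -> (1 - e) * ((1 - e) * p * r) ^+ 2 <= q (D (t + r) t)
    <= (1 + e) * ((1 + e) * p * r) ^+ 2.
  move=> rh; have rh' : 0 <= r <= h by case/andP: rh => /ltW -> ->.
  have := Dr r rh'; rewrite lt_min => /andP[_ Dr2].
  have := hq 0 (D (t + r) t); rewrite lexx mdist_ge0 => /(_ isT Dr2).
  rewrite qKN0 expr0n/= !subr0 => /andP[lo hi].
  have r0 c : 0 <= c -> 0 <= c * p * r.
    by move=> c0; rewrite !mulr_ge0//; case/andP: rh'.
  have e1B : 0 <= 1 - e by lra.
  have e1D : 0 <= 1 + e by lra.
  apply/andP; split.
    apply: le_trans lo; rewrite ler_wpM2l//.
    by rewrite lerXn2r ?nnegrE ?mdist_ge0 ?r0// tp'.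
  apply: (le_trans hi); rewrite ler_wpM2l//.
  by rewrite lerXn2r ?nnegrE ?mdist_ge0 ?r0// tp.
have ttau : 0 < tau * h by rewrite mulr_gt0//; case/andP: tau01.
have tauh : 0 < (1 - tau) * h <= h.
  by rewrite mulr_gt0 ?subr_gt0//=; [rewrite mulrBl mul1r gerBl ltW|case/andP: tau01].
pose l := 2 * ((1 + e) * G) + `|K| * (8 * (p * h) ^+ 2).
have inc : q (D (t + h) t) - q (D (t + (1 - tau) * h) t) <= l * (tau * h).
  have := @dini_increment R (fun r => q (D r t)) (t + (1 - tau) * h) (t + h) l.
  have -> : t + h - (t + (1 - tau) * h) = tau * h by rewrite mulrBl mul1r; ring.
  apply; first by rewrite lerD2l; case/andP: tauh.
    move=> r rh; apply: continuous_q_mdist; have -> : r = t + (r - t) by ring.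
    by apply: Itr; lra.
  move=> r rh; have rE : r = t + (r - t) by ring.
  have rt : 0 < r - t < h by lra.
  have [rt0 /ltW rth] := andP rt.
  have rt1 : 0 < r - t <= h by rewrite rt0.
  have rt2 : 0 <= r - t <= h by rewrite ltW.
  have rt3 : r <= t + h by rewrite -lerBlDl.
  have Ir : I r by rewrite rE; exact: Itr.
  have := Dr (r - t) rt2; rewrite -rE lt_min => /andP[Dr1 _].
  have := hE (y t) r (y_star It) Ir Dr1.
  apply: dini_le_weaken; rewrite /l lerD//.
    rewrite ler_pM2l//; apply: le_trans exG.
    rewrite /excess ler_pM2l ?oppr_gt0// lerB// ler_wpM2l ?fexpN_ge0//.
    rewrite lef_pV2 ?posrE ?fexpN_curve_gt0// ler_fexpN_curve//.
    exact: energy_nonincreasing.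
  rewrite ler_wpM2l// rE.
  have /andP[_ /le_trans] := qD (r - t) rt1; apply.
  exact: sqr_growth_le8.
have /andP[lo _] := qD h ltac:(by rewrite h0 lexx).
have /andP[_ hi] := qD ((1 - tau) * h) tauh.
have ph2 : 0 <= (p * h) ^+ 2 by exact: sqr_ge0.
have Kh : `|K| * (8 * (p * h) ^+ 2) * h <= tau * (p * h) ^+ 2.
  have -> : `|K| * (8 * (p * h) ^+ 2) * h = (8 * `|K| * h) * (p * h) ^+ 2 by ring.
  by rewrite ler_wpM2r// mulrC ltW// (lt_trans _ hh5)// ltr_pM2l// ltrDl.
have {}Kh : `|K| * (8 * (p * h) ^+ 2) * h * tau <= tau ^+ 2 * (p * h) ^+ 2.
  have -> : tau ^+ 2 * (p * h) ^+ 2 = tau * (p * h) ^+ 2 * tau by ring.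
  by rewrite ler_wpM2r//; case/andP: tau01 => /ltW.
have := @two_stage_arithmetic R tau ((p * h) ^+ 2) (G * h) tau01 ph2.
rewrite -/e; set lhs := (X in (X <= _ -> _) -> _).
have : lhs <= 2 * (1 + e) * (G * h) * tau + tau ^+ 2 * (p * h) ^+ 2.
  rewrite /lhs; move: inc lo hi Kh; rewrite /l; clear; lra.
move=> H /(_ H).
have -> : (1 - 2 * tau) * (p * h) ^+ 2 = (1 - eps) * p ^+ 2 * h * h.
  by rewrite /tau; field.
by rewrite ler_pM2r.
Qed.

(** Agreement of [G] with the energy just after [r] suffices, which covers the clamped energies as
    well as [energy_patch]. *)
Lemma cvg_drop_quotient (G : R -> R) r p : I r -> 0 <= p -> speed r p ->
  (exists2 d, 0 < d & forall x, r <= x < r + d -> G x = g x) ->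
  drop_quotient G k r @[k --> \oo] --> p ^+ 2.
Proof.
move=> Ir p0 rp [d0 d00 hG]; apply/cvgrPdist_le => eps eps0.
have pp : 0 < p ^+ 2 + 1 by rewrite ltr_wpDl// sqr_ge0.
pose e := Num.min (eps / (p ^+ 2 + 1)) (2^-1).
have e01 : 0 < e < 1.
  rewrite lt_min divr_gt0//= invr_gt0 ltr0n/= /e gt_min; apply/orP; right.
  by rewrite invf_lt1// ltr1n.
have ep : e * p ^+ 2 <= eps.
  have : e <= eps / (p ^+ 2 + 1) by rewrite /e ge_min lexx.
  by rewrite ler_pdivlMr//; case/andP: e01; lra.
have [d1 d10 hd1] := growth_sharp Ir p0 rp.1 (proj1 (andP e01)).
have [d2 d20 hd2] := energy_drop_ge Ir p0 rp e01.
apply: filterS (@cvg_harmonic_right R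
  (fun h => `|p ^+ 2 - h^-1 * (G r - G (r + h))| <= eps) _) => [k|].
  by rewrite invrK.
exists (Num.min d0 (Num.min d1 d2)); first by rewrite !lt_min d00 d10.
move=> h /andP[h0]; rewrite !lt_min => /and3P[hd0 hd1' hd2'].
have [|_ _ up] := hd1 h; first by rewrite h0.
have lo := hd2 h ltac:(by rewrite h0).
rewrite !hG; [|lra|lra].
have lo' : (1 - e) * p ^+ 2 <= h^-1 * (g r - g (r + h)).
  by rewrite ler_pdivlMl// mulrC.
have up' : h^-1 * (g r - g (r + h)) <= (1 + e) * p ^+ 2.
  by rewrite ler_pdivrMl// mulrC.
rewrite ler_norml; lra.
Qed.

Lemma cvg_metric_quotient_right r p : I r -> 0 <= p -> speed r p ->
  (k.+1%:R * D (r + k.+1%:R^-1) r) @[k --> \oo] --> p.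
Proof.
move=> Ir p0 rp; apply/cvgrPdist_le => eps eps0.
have e0 : 0 < eps / (p + 1) by rewrite divr_gt0//; lra.
have ep : eps / (p + 1) * p <= eps.
  by rewrite mulrAC ler_pdivrMr ?ler_pM2l//; lra.
have [d1 d10 hd1] := growth_sharp Ir p0 rp.1 e0.
have [d2 d20 hd2] := rp.2 eps eps0.
apply: filterS (@cvg_harmonic_right R (fun h => `|p - h^-1 * D (r + h) r| <= eps) _) => [k|].
  by rewrite invrK.
exists (Num.min d1 d2); first by rewrite lt_min d10.
move=> h /andP[h0]; rewrite lt_min => /andP[hd1' hd2'].
have [|_ up _] := hd1 h; first by rewrite h0.
have lo := hd2 h ltac:(by rewrite h0).
have lo' : p - eps <= h^-1 * D (r + h) r by rewrite ler_pdivlMl// mulrC.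
have up' : h^-1 * D (r + h) r <= (1 + eps / (p + 1)) * p by rewrite ler_pdivrMl// mulrC.
rewrite ler_norml; lra.
Qed.

(** A finite lower limit provides arbitrarily small steps [h] with energy loss at most [L' * h]; by
    [dist_sqr_le] the curve then moves by at most [Num.sqrt (C * L') * h]. *)
Lemma drop_density_speed (G : R -> R) r : I r ->
  (exists2 d, 0 < d & forall x, r <= x < r + d -> G x = g x) ->
  (drop_density G r < +oo)%E -> exists2 p, 0 <= p & speed r p.
Proof.
move=> Ir [d0 d00 hG] fin.
have [L hL] : exists L : R, (drop_density G r < L%:E)%E.
  move: fin; case: (drop_density G r) => [x _| //|_].
    by exists (x + 1); rewrite lte_fin ltrDl.
  by exists 0; rewrite ltNy0.
have [d1 d10 hd1] := timespan_ball Ir.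
have Ib : I (r + d1 / 2) by apply: hd1; rewrite addrAC subrr add0r gtr0_norm; lra.
have [C [d2 [C0 d20 hd2]]] := dist_sqr_le Ir Ib.
pose L' := Num.max L 0.
apply: (@speed_exists r (Num.sqrt (C * L'))); first exact: sqrtr_ge0.
move=> eps eps0 d dgt0.
have [n0 _ hn] := @cvg_harmonic_right R (fun h => h < Num.min (Num.min d d0) (Num.min d2 (d1 / 2)))
  ltac:(exists (Num.min (Num.min d d0) (Num.min d2 (d1 / 2))) => [|h /andP[]//];
        by rewrite !lt_min dgt0 d00 d20/=; lra).
have [k n0k] := limn_einf_lt hL n0; rewrite lte_fin.
have := hn k n0k; rewrite /drop_quotient.
have : 0 < k.+1%:R^-1 :> R by rewrite invr_gt0.
have -> : k.+1%:R = k.+1%:R^-1^-1 :> R by rewrite invrK.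
rewrite invrK; set h := k.+1%:R^-1 => h0.
rewrite !lt_min => /andP[/andP[hd hd0] /andP[hd2' hd1']].
rewrite !hG; [|lra|lra]; rewrite ltr_pdivrMl// => hdrop.
exists h; first by rewrite h0.
have := hd2 r (r + h) (lexx _) ltac:(lra) ltac:(lra) ltac:(lra).
rewrite addrAC subrr add0r (metric_sym (y r)) => hD.
have L'0 : 0 <= L' by rewrite le_max lexx orbT.
have LL' : L <= L' by rewrite le_max lexx.
have CL0 : 0 <= C * L' by rewrite mulr_ge0// ltW.
suff : D (r + h) r <= Num.sqrt (C * L') * h.
  by move/le_trans; apply; rewrite ler_pM2r//; lra.
rewrite -(@ler_pXn2r _ 2)// ?nnegrE ?mulr_ge0 ?mdist_ge0 ?sqrtr_ge0 ?(ltW h0)//.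
rewrite exprMn sqr_sqrtr//; apply: (le_trans hD).
rewrite -!mulrA ler_pM2l// expr2 mulrCA ler_pM2l//.
by apply: (le_trans (ltW hdrop)); rewrite [leRHS]mulrC ler_pM2l.
Qed.

(** * Speed almost everywhere, and energy and distance as integrals *)

Local Notation mu := (@lebesgue_measure R).


(** Right continuity combines lower semicontinuity, for the bound from below, with monotonicity, for
    the bound from above. *)
Lemma energy_clamp a b : I a -> I b -> a < b ->
  let G := fun r => g (clamp a b r) in
  [/\ {homo G : r s /~ r <= s}, forall r, `|G r| <= `|g a| + `|g b|
    & forall t, a <= t <= b -> forall eps, 0 < eps -> exists2 d, 0 < d &
        forall r, t <= r < t + d -> `|G r - G t| <= eps].
Proof.
move=> Ia Ib ab G.
have Ic r : I (clamp a b r) by apply: timespan_convex Ia Ib (clamp_bounds _ (ltW ab)).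
have Gni : {homo G : r s /~ r <= s}.
  by move=> r s rs; apply: energy_nonincreasing => //; exact: clamp_le.
split => //.
- move=> r; have /andP[ac cb] := clamp_bounds r (ltW ab).
  have := energy_nonincreasing Ia (Ic r) ac; have := energy_nonincreasing (Ic r) Ib cb.
  have := ler_norm (g a); have := ler_norm (- g b); rewrite normrN.
  have := normr_ge0 (g a); have := normr_ge0 (g b).
  by rewrite /G ler_norml; lra.
move=> t tab eps eps0.
have It : I t by exact: timespan_convex tab.
have [|d d0 hd] := @energy_lsc t (g t - eps) It; first by rewrite ltrBlDr ltrDl.
exists d => // r /andP[tr rd].
have Gt : G t = g t by rewrite /G clamp_id.
have Grt : G r <= G t by exact: Gni.
have : g t - eps < G r.
  apply: (hd _ _).2; rewrite -[in X in `|_ - X|](@clamp_id _ a b t)//.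
  by apply: le_lt_trans (clamp_dist _ _ (ltW ab)) _; rewrite ger0_norm; lra.
by rewrite -Gt ler_norml; lra.
Qed.

Lemma ae_speed a b : I a -> I b -> a < b ->
  {ae mu, forall r, a <= r < b -> exists2 p, 0 <= p & speed r p}.
Proof.
move=> Ia Ib ab; have [Gni bG cG] := energy_clamp Ia Ib ab.
have aeF := ae_filter_ringOfSetsType mu.
have cG' t : t = a \/ t = b -> _ := fun tab => cG t ltac:(case: tab => ->; lra).
have iG := integrable_drop_density (ltW ab) Gni bG cG'.
have := @integrable_ae _ _ _ mu `[a, b] ltac:(by []) _ iG.
apply: filterS => r hr rab; have Ir : I r by apply: timespan_convex Ia Ib _; lra.
apply: (@drop_density_speed (fun r => g (clamp a b r))) => //.
  by exists (b - r) => [|x xr]; [lra|rewrite clamp_id//; lra].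
have := hr ltac:(by rewrite /= in_itv/=; lra).
by rewrite fin_numE -ltey => /andP[].
Qed.

Definition energy_patch : R -> R := (fun r => g r) \_ I.

(** A single measurable function for the right speed on the whole time span, free of the choice of
    an interval [[a, b]]. The default value of [fine] at infinite densities matters only on a null
    set. *)
Definition max_speed r : R := Num.sqrt (fine (drop_density energy_patch r)).

Lemma measurable_energy_patch : measurable_fun [set: R] energy_patch.
Proof.
have mI : measurable I by apply: open_measurable; exact: open_timespan.
apply/(measurable_restrictT _ mI).
apply: (measurability (@RGenCInfty.G R)) => [|/= _ [_] [r] -> <-].
  exact: RGenCInfty.measurableE.
(* By monotonicity the superlevel sets of the energy are intervals. *)
apply: is_interval_measurable => s t /= [Is].
rewrite !in_itv/= !andbT => gs [It gt] u sut.
have Iu : I u by exact: timespan_convex sut.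
split=> //; rewrite in_itv/= andbT (le_trans gt)//.
by apply: energy_nonincreasing => //; case/andP: sut.
Qed.

Lemma measurable_max_speed : measurable_fun [set: R] max_speed.
Proof.
apply: (measurableT_comp (f := @Num.sqrt R)).
  by apply: continuous_measurable_fun; exact: sqrt_continuous.
apply: measurableT_comp; first exact: fine_measurable.
by apply: measurable_drop_density; exact: measurable_energy_patch.
Qed.

Lemma max_speed_ge0 r : 0 <= max_speed r.
Proof. exact: sqrtr_ge0. Qed.

Lemma max_speedE r p : I r -> 0 <= p -> speed r p -> max_speed r = p.
Proof.
move=> Ir p0 rp; rewrite /max_speed /drop_density.
have [d d0 hd] := timespan_ball Ir.
have lim : drop_quotient energy_patch k r @[k --> \oo] --> p ^+ 2.
  apply: (cvg_drop_quotient Ir p0 rp); exists d => // x xr.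
  rewrite /energy_patch patchE mem_set//; apply: hd.
  by rewrite ger0_norm; lra.
have : ((drop_quotient energy_patch k r)%:E @[k --> \oo] --> (p ^+ 2)%:E).
  by apply/cvg_EFin => //; exact: nearW.
by move=> /cvg_limn_einf_sup[-> _]; rewrite /= sqrtr_sqr ger0_norm.
Qed.

Lemma timespan_gt t : I t -> exists2 b, I b & t < b.
Proof.
move=> It; have [d d0 hd] := timespan_ball It; exists (t + d / 2); last by lra.
by apply: hd; rewrite addrAC subrr add0r gtr0_norm; lra.
Qed.

(** Almost everywhere this is the drop density of the energy clamped to [[s, b]], integrable by
    Fatou; taking [b > t] keeps the clamp inactive just after each point of [[s, t]]. *)
Lemma integrable_max_speed_sqr s t : I s -> I t ->
  mu.-integrable `[s, t] (EFin \o (fun r => max_speed r ^+ 2)).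
Proof.
move=> Is It; have [ts|st] := ltP t s.
  by rewrite set_itv_ge ?bnd_simp -?ltNge//; exact: integrable_set0.
have [b Ib tb] := timespan_gt It; have sb := le_lt_trans st tb.
have [Gni bG cG] := energy_clamp Is Ib sb.
have aeF := ae_filter_ringOfSetsType mu.
have cG' u : u = s \/ u = b -> _ := fun usb => cG u ltac:(case: usb => ->; lra).
have iG := integrable_drop_density (ltW sb) Gni bG cG'.
have {}iG : mu.-integrable `[s, t] (drop_density (fun r => g (clamp s b r))).
  by apply: integrableS iG => //; apply: subset_itvl; rewrite bnd_simp ltW.
have msq : measurable_fun [set: R] (fun r => max_speed r ^+ 2).
  by apply: measurable_funX; exact: measurable_max_speed.
have /integrableP[mG foo] := iG.
apply/integrableP; split; first by apply/measurable_EFinP/measurable_funTS.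
apply: le_lt_trans foo; rewrite le_eqVlt; apply/orP; left; apply/eqP.
apply: ge0_ae_eq_integral_nonmeasurable => //.
apply: filterS (ae_speed Is Ib sb) => r hr; rewrite /= in_itv/= => rst.
have [|p p0 rp] := hr; first by lra.
have Ir : I r by exact: timespan_convex rst.
rewrite (max_speedE Ir p0 rp).
have lim : drop_quotient (fun r => g (clamp s b r)) k r @[k --> \oo] --> p ^+ 2.
  apply: (cvg_drop_quotient Ir p0 rp); exists (b - r) => [|x xr]; first by lra.
  by rewrite clamp_id//; lra.
have : ((drop_quotient (fun r => g (clamp s b r)) k r)%:E @[k --> \oo] --> (p ^+ 2)%:E).
  by apply/cvg_EFin => //; exact: nearW.
by move=> /cvg_limn_einf_sup[E _]; rewrite /drop_density E.
Qed.

Lemma integrable_max_speed s t : I s -> I t ->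
  mu.-integrable `[s, t] (EFin \o max_speed).
Proof.
move=> Is It.
have i1 : mu.-integrable `[s, t] (EFin \o cst (1 : R)).
  apply: (@bounded_measurable_integrable _ _ 1) => //.
  - exact: lebesgue_measure_segment_lty.
  - by move=> r; rewrite normr1.
apply: le_integrable (integrableD _ i1 (integrable_max_speed_sqr Is It)) => //.
  by apply/measurable_EFinP/measurable_funTS; exact: measurable_max_speed.
move=> r _ /=; rewrite lee_fin ger0_norm ?max_speed_ge0// ger0_norm; last first.
  by rewrite addr_ge0// sqr_ge0.
have := max_speed_ge0 r; move: (max_speed r) => x x0; nra.
Qed.

Lemma cvg_shifted (u : nat -> R) (l : R) (k0 : nat) : u k @[k --> \oo] --> l ->
  u (n + k0)%N @[n --> \oo] --> l.
Proof. by move=> ul; apply: cvg_comp ul; exact: cvg_addnr. Qed.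

Lemma harmonic_lt (d : R) : 0 < d -> exists k0, forall n,
  0 < ((n + k0).+1%:R^-1 : R) < d.
Proof.
move=> d0; have [k0 _ hk] := @cvg_harmonic_right R (fun h => 0 < h < d)
  ltac:(by exists d).
by exists k0 => n; apply: hk; exact: leq_addl.
Qed.

Lemma energy_integral s t : I s -> I t -> s <= t ->
  \int[mu]_(r in `[s, t]) (max_speed r ^+ 2) = g s - g t.
Proof.
move=> Is It st; have [b Ib tb] := timespan_gt It; have sb := le_lt_trans st tb.
have [Gni bG cG] := energy_clamp Is Ib sb.
set G := (fun r => g (clamp s b r)) in Gni bG cG.
have [C [d [C0 d0 hd]]] := growth_uniform Is Ib.
(* The steps from [k0] on are short enough for [growth_uniform] and do not leave [[s, b]], where the
   clamp is the identity. *)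
have [|k0 hk0] := @harmonic_lt (Num.min d (b - t)); first by rewrite lt_min d0 subr_gt0.
have mG : measurable_fun [set: R] G by apply: nonincreasing_measurable => // r u; exact: Gni.
have lim1 := @cvg_Rintegral_drop_quotient R G _ s t st Gni bG
  (fun u ust => cG u ltac:(case: ust => ->; lra)).
have lim2 := @Rintegral_dominated_cvg R (fun n => drop_quotient G (n + k0))
  (fun r => max_speed r ^+ 2) (fun r => C * max_speed r ^+ 2) s t.
have -> : g s - g t = G s - G t by rewrite /G !clamp_id//; lra.
apply: (cvg_unique _ _ (cvg_shifted k0 lim1)); first exact: Rhausdorff.
apply: lim2.
- by move=> n; exact: measurable_drop_quotient.
- by apply: measurable_funX; exact: measurable_max_speed.
- exact: (integrableZl _ C (integrable_max_speed_sqr Is It)).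
have aeF := ae_filter_ringOfSetsType mu.
apply: filterS (ae_speed Is Ib sb) => r hr rst.
have [|p p0 rp] := hr; first by lra.
have Ir : I r by exact: timespan_convex rst.
rewrite (max_speedE Ir p0 rp); split.
  apply: (@cvg_shifted (fun k => drop_quotient G k r) (p ^+ 2) k0).
  apply: (cvg_drop_quotient Ir p0 rp).
  exists (b - r); first by lra.
  by move=> x xr; rewrite /G clamp_id//; lra.
move=> n; have := hk0 n; rewrite /drop_quotient.
set h := (n + k0).+1%:R^-1 => /andP[h0]; rewrite lt_min => /andP[hd' hbt].
have -> : (n + k0).+1%:R = h^-1 by rewrite /h invrK.
have hV0 : 0 <= h^-1 by rewrite invr_ge0 ltW.
rewrite ger0_norm; last by rewrite mulr_ge0// subr_ge0 Gni// lerDl ltW.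
rewrite ler_pdivrMl// /G !clamp_id; [|lra|lra].
have [||_] := hd r h p ltac:(lra) _ _ p0 rp.1; [by rewrite (ltW h0)|lra|].
by rewrite [X in _ <= X -> _]mulrC.
Qed.

(** The difference quotients of the distance to [y s] have integrals tending to [D t s], and by the
    triangle inequality they are at most the metric quotients of the curve, which converge to the
    speed under the domination [C * max_speed]. *)
Lemma dist_le_integral s t : I s -> I t -> s <= t ->
  D t s <= \int[mu]_(r in `[s, t]) max_speed r.
Proof.
move=> Is It st; have [b Ib tb] := timespan_gt It; have sb := le_lt_trans st tb.
have Isb r : s <= r <= b -> I r by exact: timespan_convex.
have [C [d [C0 d0 hd]]] := growth_uniform Is Ib.
have [|k0 hk0] := @harmonic_lt (Num.min d (b - t)); first by rewrite lt_min d0 subr_gt0.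
pose yc r := y (clamp s b r); pose phi r := mdist (yc r) (y s).
have ycu eps : 0 < eps -> exists2 d, 0 < d &
    forall r r', `|r - r'| < d -> mdist (yc r) (yc r') < eps.
  move=> /(@curve_uniform_continuity R X y s b (fun r rsb => cy (Isb r rsb)))[e e0 he].
  exists e => // r r' rr'; apply: he; rewrite ?clamp_bounds ?ltW//.
  exact: le_lt_trans (clamp_dist _ _ (ltW sb)) _.
have cdist h : continuous (fun r => mdist (yc (r + h)) (yc r)).
  move=> r; apply/cvgrPdist_lt => eps eps0.
  have [e e0 he] := ycu (eps / 2) ltac:(lra).
  apply/nbhs_ballP; exists e => // r'; rewrite /ball/= => rr'.
  have h1 : mdist (yc r) (yc r') < eps / 2 by exact: he.
  have h2 : mdist (yc (r + h)) (yc (r' + h)) < eps / 2.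
    by apply: he; rewrite opprD addrACA subrr addr0.
  have := mdist_dist (yc (r + h)) (yc (r' + h)) (yc r).
  have := mdist_dist (yc r) (yc r') (yc (r' + h)).
  rewrite (metric_sym (yc r) (yc (r' + h))) (metric_sym (yc r') (yc (r' + h))).
  by rewrite !ler_norml ltr_norml; lra.
have cphi : continuous phi.
  move=> r; apply: continuous_mdistl; apply/cvg_ballP => eps /ycu[e e0 he].
  apply/nbhs_ballP; exists e => // r' rr'.
  by rewrite /= ballEmdist/=; apply: he; exact: rr'.
have [c csb hc] := @EVT_max R phi s b (ltW sb) ltac:(by apply: continuous_subspaceT).
have bphi r : `|phi r| <= phi c.
  rewrite ger0_norm ?mdist_ge0//; have -> : phi r = phi (clamp s b r).
    by rewrite /phi /yc (clamp_id (clamp_bounds _ _)) ?ltW// clamp_bounds// ltW.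
  by apply: hc; rewrite in_itv/= clamp_bounds// ltW.
have right u : forall eps, 0 < eps -> exists2 d, 0 < d &
    forall r, u <= r < u + d -> `|phi r - phi u| <= eps.
  move=> eps /ycu[e e0 he]; exists e => // r ur.
  apply: le_trans (mdist_dist _ _ _) (ltW _); apply: he.
  by rewrite ger0_norm; lra.
have mphi : measurable_fun [set: R] phi by exact: continuous_measurable_fun.
have lim1 := cvg_Rintegral_difference_quotient st mphi bphi (right s) (right t).
pose u k r := k.+1%:R * mdist (yc (r + k.+1%:R^-1)) (yc r).
have mu_ k : measurable_fun [set: R] (u k).
  by apply: measurable_funM; [exact: measurable_cst|exact: continuous_measurable_fun].
have bu k r : `|u k r| <= k.+1%:R * (phi c + phi c).
  rewrite normrM ger0_norm// ler_wpM2l// ger0_norm ?mdist_ge0//.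
  apply: le_trans (metric_triangle _ (y s) _) _; rewrite lerD//.
    by have := bphi (r + k.+1%:R^-1); rewrite ger0_norm ?mdist_ge0.
  by rewrite metric_sym; have := bphi r; rewrite ger0_norm ?mdist_ge0.
have lim2 : (\int[mu]_(r in `[s, t]) u (n + k0)%N r) @[n --> \oo] -->
    \int[mu]_(r in `[s, t]) max_speed r.
  apply: (@Rintegral_dominated_cvg R _ _ (fun r => C * max_speed r)) => //.
  - exact: measurable_max_speed.
  - exact: (integrableZl _ C (integrable_max_speed Is It)).
  have aeF := ae_filter_ringOfSetsType mu.
  apply: filterS (ae_speed Is Ib sb) => r hr rst.
  have [|p p0 rp] := hr; first by lra.
  have Ir : I r by exact: timespan_convex rst.
  have uE n : u (n + k0)%N r = (n + k0).+1%:R * D (r + (n + k0).+1%:R^-1) r.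
    have /andP[] := hk0 n; rewrite /u /yc; set h := _^-1.
    by rewrite lt_min => h0 /andP[_ hbt]; rewrite !clamp_id; lra.
  rewrite (max_speedE Ir p0 rp); split.
    under eq_fun do rewrite uE.
    exact: (@cvg_shifted (fun k => k.+1%:R * D (r + k.+1%:R^-1) r) p k0
      (cvg_metric_quotient_right Ir p0 rp)).
  move=> n; rewrite uE; have := hk0 n.
  set h := (n + k0).+1%:R^-1 => /andP[h0]; rewrite lt_min => /andP[hd' hbt].
  have -> : (n + k0).+1%:R = h^-1 by rewrite /h invrK.
  have hV0 : 0 <= h^-1 by rewrite invr_ge0 ltW.
  rewrite ger0_norm; last by rewrite mulr_ge0 ?mdist_ge0.
  rewrite ler_pdivrMl//.
  have [||up _] := hd r h p ltac:(lra) _ _ p0 rp.1; [by rewrite (ltW h0)|lra|].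
  by rewrite mulrC.
have -> : D t s = phi t - phi s.
  by rewrite /phi /yc !clamp_id ?mdistxx ?subr0//; lra.
apply: (ler_cvg_to (cvg_shifted k0 lim1) lim2).
apply: nearW => n; apply: le_Rintegral => //.
- apply: (@bounded_measurable_integrable _ _ ((n + k0).+1%:R * (phi c + phi c))) => //.
  + exact: lebesgue_measure_segment_lty.
  + apply: measurable_funM; first exact: measurable_cst.
    by apply: measurable_funB => //; exact: (measurableT_comp mphi (measurable_shift _)).
  + move=> r; rewrite normrM ger0_norm// ler_wpM2l//.
    by rewrite (le_trans (ler_normB _ _))// lerD.
- apply: (@bounded_measurable_integrable _ _ ((n + k0).+1%:R * (phi c + phi c))) => //.
  exact: lebesgue_measure_segment_lty.
move=> r _; rewrite ler_wpM2l//.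
by apply: le_trans (ler_norm _) _; exact: mdist_dist.
Qed.

Lemma ae_derivable_energy :
  {ae mu, forall r, I r -> derivable ((fun t => g t) : R^o -> R^o) r 1 /\
    derive1 ((fun t => g t) : R^o -> R^o) r = - max_speed r ^+ 2}.
Proof.
apply: ae_timespan => a b Ia Ib ab; have aeF := ae_filter_ringOfSetsType mu.
have iab := integrable_max_speed_sqr Ia Ib.
(* Lebesgue differentiation is applied to the density cut off outside [[a, b]], which is integrable
   on the line. *)
pose sigma : R -> R := (fun r => max_speed r ^+ 2) \_ `[a, b].
have sigmaE x : a <= x <= b -> sigma x = max_speed x ^+ 2.
  by move=> xab; rewrite /sigma patchE mem_set//= in_itv.
have intsigma : mu.-integrable `[a, b] (EFin \o sigma).
  apply: eq_integrable iab => // x; rewrite inE/= in_itv/= => xab.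
  by rewrite sigmaE.
apply: filterS (lebesgue_differentiation (integrable_locally _ iab)) => // x lx xab.
have [axb xb] := andP xab.
have [|dF dFx] := @FTC1_lebesgue_pt R sigma (BLeft a) x b xb intsigma _ lx.
  by rewrite /= lte_fin.
set Phi := (fun y0 : R => _) in dF dFx.
have nearE : {near x, ((fun t => g a - Phi t) : R^o -> R^o) =1 ((fun t => g t) : R^o -> R^o)}.
  near=> t.
  have tab : a < t < b.
    by apply/andP; split; near: t; [exact: lt_nbhsr|exact: lt_nbhsl].
  have It : I t by apply: timespan_convex Ia Ib _; lra.
  have -> : Phi t = g a - g t.
    rewrite -(energy_integral Ia It); last by lra.
    apply: eq_Rintegral => r; rewrite inE/= in_itv/= => rat; rewrite sigmaE//; lra.
  by rewrite opprB addrC subrK.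
have dcst : derivable ((fun=> g a) : R^o -> R^o) x 1 by exact: derivable_cst.
have dB := derivableB dcst dF.
split; first exact: near_eq_derivable nearE dB.
rewrite derive1E -(@near_eq_derive R R^o R^o _ _ x 1 nearE) (deriveB dcst dF) derive_cst sub0r.
by rewrite -derive1E dFx sigmaE//; lra.
Unshelve. all: by end_near. Qed.

(** * Behaviour from the left and the two-sided metric derivative *)

Lemma derive1_left_drop (u : R^o -> R^o) r l : derivable u r 1 -> derive1 u r = - l ->
  forall e, 0 < e -> exists2 d, 0 < d & forall h, 0 < h < d ->
    `|u (r - h) - u r - l * h| <= e * h.
Proof.
move=> du ul e e0; move: du => /cvgrPdist_le/(_ _ e0).
rewrite -/('D_1 u r) -derive1E ul.
case/nbhs_ballP => d /= d0 hd; exists d => // h /andP[h0 hd'].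
have : `|- l - (- h)^-1 *: (u ((- h) *: 1 + r) - u r)| <= e.
  apply: (hd (- h)); last by rewrite oppr_eq0 gt_eqF.
  by rewrite /ball/= sub0r opprK gtr0_norm.
rewrite /GRing.scale/= mulr1 (addrC (- h)) => /(ler_wpM2r (ltW h0)).
rewrite -[X in _ * X <= _ -> _](gtr0_norm h0) -normrM; apply: le_trans.
rewrite le_eqVlt; apply/orP; left; apply/eqP; congr (`|_|).
by field; rewrite gt_eqF.
Qed.

Lemma metric_quotient_right_dist r p : I r -> 0 <= p -> speed r p ->
  forall eps, 0 < eps -> exists2 d, 0 < d & forall h, 0 < h < d ->
    `|D (r + h) r / h - p| <= eps.
Proof.
move=> Ir p0 rp eps eps0.
have e0 : 0 < eps / (p + 1) by rewrite divr_gt0//; lra.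
have ep : eps / (p + 1) * p <= eps.
  by rewrite mulrAC ler_pdivrMr ?ler_pM2l//; lra.
have [d1 d10 hd1] := growth_sharp Ir p0 rp.1 e0.
have [d2 d20 hd2] := rp.2 eps eps0.
exists (Num.min d1 d2); first by rewrite lt_min d10.
move=> h /andP[h0]; rewrite lt_min => /andP[hd1' hd2'].
have [|_ up _] := hd1 h; first by rewrite h0.
have lo := hd2 h ltac:(by rewrite h0).
have lo' : p - eps <= D (r + h) r / h by rewrite ler_pdivlMr.
have up' : D (r + h) r / h <= (1 + eps / (p + 1)) * p by rewrite ler_pdivrMr.
rewrite ler_norml; lra.
Qed.

(* By AM-GM, [int m <= (int m ^ 2 / c + c * h) / 2]; the choice [c ~ p] is sharp. *)
Lemma dist_left_le r p : I r -> 0 <= p ->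
  derivable ((fun t => g t) : R^o -> R^o) r 1 ->
  derive1 ((fun t => g t) : R^o -> R^o) r = - p ^+ 2 ->
  forall eps, 0 < eps -> exists2 d, 0 < d & forall h, 0 < h < d ->
    D (r - h) r <= (p + eps) * h.
Proof.
move=> Ir p0 dg g'p eps eps0.
(* The shift by [eps / 2] keeps the weight positive when [p = 0]. *)
pose c := p + eps / 2; have c0 : 0 < c by rewrite /c; lra.
have [d1 d10 hd1] := derive1_left_drop dg g'p (mulr_gt0 eps0 c0).
have [d2 d20 hd2] := timespan_ball Ir.
exists (Num.min d1 d2); first by rewrite lt_min d10.
move=> h /andP[h0]; rewrite lt_min => /andP[hd1' hd2'].
have Irh : I (r - h) by apply: hd2; rewrite addrAC subrr sub0r normrN gtr0_norm.
have rhr : r - h <= r by lra.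
rewrite metric_sym; apply: (le_trans (dist_le_integral Irh Ir rhr)).
have isq := integrable_max_speed_sqr Irh Ir.
have i1 : mu.-integrable `[r - h, r] (EFin \o cst (c / 2)).
  apply: (@bounded_measurable_integrable _ _ `|c / 2|) => //.
  exact: lebesgue_measure_segment_lty.
have isqc : mu.-integrable `[r - h, r] (EFin \o (fun x => (2 * c)^-1 * max_speed x ^+ 2)).
  exact: (integrableZl _ (2 * c)^-1 isq).
apply: (@le_trans _ _ (\int[mu]_(x in `[r - h, r])
    ((2 * c)^-1 * max_speed x ^+ 2 + cst (c / 2) x))).
  apply: le_Rintegral => //; first exact: integrable_max_speed.
    exact: (integrableD _ isqc i1).
  move=> x _ /=; rewrite -(ler_pM2l (_ : 0 < 2 * c)); last by lra.
  have -> : 2 * c * ((2 * c)^-1 * max_speed x ^+ 2 + c / 2) = max_speed x ^+ 2 + c ^+ 2.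
    by field; rewrite gt_eqF.
  have := sqr_ge0 (max_speed x - c); rewrite sqrrB; lra.
rewrite RintegralD// RintegralZl// Rintegral_cst// energy_integral//.
have -> : fine (mu `[r - h, r]) = h.
  by rewrite lebesgue_measure_itv/= lte_fin ltrBlDr ltrDl h0 /=; lra.
have := hd1 h ltac:(by rewrite h0); rewrite ler_norml => /andP[_ up].
have up' : g (r - h) - g r <= (p ^+ 2 + eps * c) * h by lra.
have : (2 * c)^-1 * (g (r - h) - g r) <= (2 * c)^-1 * ((p ^+ 2 + eps * c) * h).
  by rewrite ler_wpM2l// invr_ge0; lra.
move/le_trans => H; have : (2 * c)^-1 * (p ^+ 2 + eps * c) <= c / 2 + eps / 2.
  rewrite ler_pdivrMl; last by lra.
  by have := sqr_ge0 (c - p); rewrite /c; nra.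
move=> /(ler_wpM2r (ltW h0)) H2; have := H _ (le_trans _ H2).
rewrite mulrA lexx => /(_ isT); rewrite /c; lra.
Qed.

Lemma one_sub_expR_ge (u e : R) : 0 <= u <= e -> 0 < e -> (1 - e) * u <= 1 - expR (- u).
Proof.
move=> /andP[u0 ue] e0.
have h1 : 1 + u <= expR u by exact: expR_ge1Dx.
have pos : 0 < 1 + u by lra.
have : expR (- u) <= (1 + u)^-1 by rewrite expRN lef_pV2 ?posrE ?expR_gt0.
have -> : (1 + u)^-1 = 1 - u + u ^+ 2 * (1 + u)^-1 by field; rewrite gt_eqF.
have : u ^+ 2 * (1 + u)^-1 <= u ^+ 2.
  by rewrite ler_piMr ?sqr_ge0// invf_le1//; lra.
have : u * u <= e * u by rewrite ler_wpM2r.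
by rewrite expr2; lra.
Qed.

(** By the derivative of the energy, [g (r - x)] exceeds [g r] by at least [(p ^+ 2 - e) * x]; the
    factor [1 - e] pays for the exponential in the excess. *)
Lemma excess_left_le r p e : I r -> 
  derivable ((fun t => g t) : R^o -> R^o) r 1 ->
  derive1 ((fun t => g t) : R^o -> R^o) r = - p ^+ 2 ->
  0 < e < 1 -> e <= p ^+ 2 ->
  exists2 d, 0 < d & forall x, 0 <= x < d -> I (r - x) /\
    2 * excess (y r) (r - x) <= - (2 * ((1 - e) * (p ^+ 2 - e)) * x).
Proof.
move=> Ir dg g'p e01 epp; have e0 : 0 < e by lra.
have n0 : 0 < - N by rewrite oppr_gt0.
have pp1 : 0 < p ^+ 2 + 1 by rewrite ltr_wpDl ?sqr_ge0.
have [d1 d10 hd1] := derive1_left_drop dg g'p e0.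
have [d2 d20 hd2] := timespan_ball Ir.
pose d3 := e * - N / (p ^+ 2 + 1).
have d30 : 0 < d3 by rewrite divr_gt0 ?mulr_gt0.
exists (Num.min d1 (Num.min d2 d3)); first by rewrite !lt_min d10 d20.
move=> x /andP[]; rewrite !lt_min => + /and3P[hx1 hx2].
rewrite /d3 ltr_pdivlMr// le_eqVlt => /predU1P[<- _|x0 hx3].
  rewrite subr0 mulr0 oppr0; split => //.
  by rewrite /excess divff ?gt_eqF ?fexpN_curve_gt0// subrr !mulr0.
have Ix : I (r - x) by apply: hd2; rewrite addrAC subrr sub0r normrN gtr0_norm.
split => //; have := hd1 x ltac:(by rewrite x0).
rewrite ler_norml => /andP[lo up].
pose u := (p ^+ 2 - e) * x / - N.
have pe0 : 0 <= p ^+ 2 - e by rewrite subr_ge0.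
have u0 : 0 <= u.
  by apply: divr_ge0; [apply: mulr_ge0 => //; exact: ltW|exact: ltW].
have ue : u <= e.
  rewrite ler_pdivrMr//.
  have : 0 < e * x by rewrite mulr_gt0.
  by lra.
have := @one_sub_expR_ge u e ltac:(by rewrite u0) e0.
have : F (y r) / F (y (r - x)) <= expR (- u).
  rewrite !fexpN_curve// -expRN -expRD ler_expR -mulNr -mulrDl.
  rewrite /u -mulNr ler_pM2r ?invr_gt0//; lra.
rewrite /excess => h1 h2.
have : - N * (F (y r) / F (y (r - x)) - 1) <= - N * (- ((1 - e) * u)).
  by rewrite ler_pM2l//; lra.
have -> : - N * (- ((1 - e) * u)) = - ((1 - e) * (p ^+ 2 - e) * x).
  by rewrite /u; field; rewrite lt_eqF.
by lra.
Qed.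

(** By [dist_left_le] with tolerance 1 the distance is at most [(p + 1) * x], so [q] is of order
    [h ^+ 2] and its product with |K| is below [e * h] for small [h]. *)
Lemma q_left_small r p e eta : I r -> 0 <= p ->
  derivable ((fun t => g t) : R^o -> R^o) r 1 ->
  derive1 ((fun t => g t) : R^o -> R^o) r = - p ^+ 2 ->
  0 < e < 1 -> 0 < eta -> exists2 d, 0 < d & forall x h, 0 <= x <= h -> h < d ->
    [/\ D (r - x) r < eta, q (D (r - x) r) <= (1 + e) * D (r - x) r ^+ 2
      & `|K| * q (D (r - x) r) <= e * h].
Proof.
move=> Ir p0 dg g'p e01 eta0.
have [eta2 eta20 hq] := qKN_increments K N_lt0 e01.
have m0 : 0 < Num.min eta eta2 by rewrite lt_min eta0.
have [d1 d10 hd1] := continuous_mdist (cy Ir) m0.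
have [d3 d30 hd3] := dist_left_le Ir p0 dg g'p ltr01.
have K0 : 0 <= `|K| by exact: normr_ge0.
have B0 : 0 < 2 * `|K| * (p + 1) ^+ 2 + 1.
  have : 0 <= 2 * `|K| * (p + 1) ^+ 2.
    by apply: mulr_ge0; [exact: mulr_ge0|exact: sqr_ge0].
  by lra.
have e0 : 0 < e by lra.
pose d5 := e / (2 * `|K| * (p + 1) ^+ 2 + 1).
have d50 : 0 < d5 by rewrite divr_gt0.
exists (Num.min d1 (Num.min d3 d5)); first by rewrite !lt_min d10 d30.
move=> x h /andP[x0 xh]; rewrite !lt_min => /and3P[hh1 hh3].
rewrite /d5 ltr_pdivlMr// => hh5; have h0 : 0 <= h by lra.
have : D (r - x) r < Num.min eta eta2.
  by apply: hd1; rewrite addrAC subrr sub0r normrN ger0_norm//; lra.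
rewrite lt_min => /andP[Dx1 Dx2].
have qx : q (D (r - x) r) <= (1 + e) * D (r - x) r ^+ 2.
  have := hq 0 (D (r - x) r); rewrite lexx mdist_ge0 => /(_ isT Dx2) /andP[_].
  by rewrite qKN0 expr0n/= !subr0.
split => //; have Dp : D (r - x) r <= (p + 1) * x.
  move: x0; rewrite le_eqVlt => /predU1P[<-|x0]; first by rewrite subr0 mdistxx mulr0.
  by apply: hd3; rewrite x0; lra.
have D2 : D (r - x) r ^+ 2 <= (p + 1) ^+ 2 * h ^+ 2.
  rewrite -exprMn lerXn2r ?nnegrE ?mdist_ge0//; first by rewrite mulr_ge0//; lra.
  by apply: (le_trans Dp); rewrite ler_pM2l//; lra.
have q2 : q (D (r - x) r) <= 2 * ((p + 1) ^+ 2 * h ^+ 2).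
  by apply: (le_trans qx); rewrite ler_pM ?sqr_ge0//; lra.
apply: (le_trans (ler_wpM2l K0 q2)).
have : h * (2 * `|K| * (p + 1) ^+ 2 + 1) * h <= e * h by rewrite ler_wpM2r// ltW.
have := sqr_ge0 h; lra.
Qed.

(* Integrating the EVI with [z = y r] over [r - h, r]: there the excess is about
   [- p ^+ 2 * (r - s)], hence [D (r - h) r ^+ 2 >= p ^+ 2 * h ^+ 2] up to [o(h ^+ 2)]. *)
Lemma dist_left_ge r p : I r -> 0 <= p ->
  derivable ((fun t => g t) : R^o -> R^o) r 1 ->
  derive1 ((fun t => g t) : R^o -> R^o) r = - p ^+ 2 ->
  forall eps, 0 < eps -> exists2 d, 0 < d & forall h, 0 < h < d ->
    (p - eps) * h <= D (r - h) r.
Proof.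
move=> Ir p0 dg g'p eps eps0.
have [peps|epsp] := leP p eps.
  exists 1 => // h /andP[h0 _]; apply: le_trans (mdist_ge0 _ _).
  by rewrite pmulr_lle0//; lra.
have pgt0 : 0 < p by lra.
have pp0 : 0 < p ^+ 2 by rewrite exprn_gt0.
have pp1 : 0 < 2 * (p ^+ 2 + 1) by lra.
(* The second bound is required by [excess_left_le]; the third one makes
   [(1 + e) * (p - eps) ^+ 2 <= A - e] below. *)
pose e := Num.min (2^-1) (Num.min (p ^+ 2) (eps * p / (2 * (p ^+ 2 + 1)))).
have e0 : 0 < e by rewrite !lt_min invr_gt0 ltr0n pp0 divr_gt0// mulr_gt0.
have e2 : e <= 2^-1 by rewrite ge_min lexx.
have epp : e <= p ^+ 2 by rewrite !ge_min lexx orbT.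
have eeps : e * (2 * (p ^+ 2 + 1)) <= eps * p.
  by rewrite -ler_pdivlMr// /e !ge_min lexx !orbT.
move: (e) e0 e2 epp eeps => {}e e0 e2 epp eeps.
have e01 : 0 < e < 1 by lra.
have [eta1 eta10 hE] := evi_dini.
have [d1 d10 hd1] := excess_left_le Ir dg g'p e01 epp.
have [d2 d20 hd2] := q_left_small Ir p0 dg g'p e01 eta10.
exists (Num.min d1 d2); first by rewrite lt_min d10.
move=> h /andP[h0]; rewrite lt_min => /andP[hh1 hh2].
pose A := (1 - e) * (p ^+ 2 - e).
have A0 : 0 <= A by rewrite mulr_ge0//; lra.
(* The derivative [2 * A * (r - s)] of the subtracted square compensates the bound on the excess, so
   that only the constant rate [e * h] remains. *)
have inc : (q (D r r) - A * (r - r) ^+ 2) - (q (D (r - h) r) - A * (r - (r - h)) ^+ 2)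
    <= e * h * (r - (r - h)).
  apply: (@dini_increment R (fun s => q (D s r) - A * (r - s) ^+ 2)); first by lra.
    move=> s sr; have sE : s = r - (r - s) by lra.
    have [Is _] := hd1 (r - s) ltac:(lra); rewrite -sE in Is.
    apply: cvgB; first exact: continuous_q_mdist.
    apply: cvgM; first exact: cvg_cst.
    apply: (@continuous_comp _ _ _ (fun s => r - s) (fun x => x ^+ 2)).
      by apply: cvgB; [exact: cvg_cst|exact: cvg_id].
    exact: exprn_continuous.
  move=> s sr; have sE : s = r - (r - s) by lra.
  have [Is ex] := hd1 (r - s) ltac:(lra); rewrite -sE in Is ex.
  have [Ds _ Ks] := hd2 (r - s) h ltac:(lra) hh2; rewrite -sE in Ds Ks.
  move=> e1 e10; have [d d0 hd] := hE (y r) s (y_star Ir) Is Ds e1 e10.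
  exists d => // x xd; have := hd x xd; have x0 : 0 < x by case/andP: xd.
  set q1 := q (D (s + x) r); set q0 := q (D s r) => hx.
  have hx' : q1 - q0 <= (- (2 * A * (r - s)) + e * h + e1) * x.
    apply: (le_trans hx); rewrite ler_pM2r//; move: ex Ks; rewrite /q0 /A; lra.
  have Ax : 0 <= A * x ^+ 2 by rewrite mulr_ge0// sqr_ge0.
  by move: hx' Ax; lra.
have {}inc : (A - e) * h ^+ 2 <= q (D (r - h) r).
  by move: inc; rewrite mdistxx qKN0 subrr expr0n/=; lra.
have [_ qx _] := hd2 h h ltac:(lra) hh2.
have := le_trans inc qx; set x := D (r - h) r => hx.
have x0 : 0 <= x by exact: mdist_ge0.
have A1 : (1 + e) * (p - eps) ^+ 2 <= A - e.
  have a1 : (p - eps) ^+ 2 <= p ^+ 2 - eps * p.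
    have : eps * eps <= eps * p by rewrite ler_pM2l// ltW.
    by rewrite sqrrB expr2; lra.
  have a2 : (1 + e) * (p - eps) ^+ 2 <= (1 + e) * (p ^+ 2 - eps * p).
    by rewrite ler_pM2l//; lra.
  have a3 : 0 <= e * (eps * p) by rewrite !mulr_ge0// ltW.
  have a4 : 0 <= e * e by rewrite mulr_ge0// ltW.
  by rewrite /A; move: a2 a3 a4 eeps; lra.
have hh0 : 0 <= (p - eps) * h by rewrite mulr_ge0//; lra.
rewrite -(@ler_pXn2r _ 2)// ?nnegrE// exprMn -(ler_pM2l (_ : 0 < 1 + e)); last by lra.
by apply: le_trans hx; rewrite mulrA ler_wpM2r// sqr_ge0.
Qed.

Lemma metric_derivative_curve r p : I r -> 0 <= p -> speed r p ->
  derivable ((fun t => g t) : R^o -> R^o) r 1 ->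
  derive1 ((fun t => g t) : R^o -> R^o) r = - p ^+ 2 ->
  metric_derivable y r /\ metric_derivative y r = p.
Proof.
move=> Ir p0 rp dg g'p.
suff lim : metric_quotient y r h @[h --> 0^'] --> p.
  by split; [apply/cvg_ex; exists p|apply/cvg_lim => //; exact: Rhausdorff].
apply/cvgrPdist_le => eps eps0.
have [d1 d10 hd1] := metric_quotient_right_dist Ir p0 rp eps0.
have [d2 d20 hd2] := dist_left_le Ir p0 dg g'p eps0.
have [d3 d30 hd3] := dist_left_ge Ir p0 dg g'p eps0.
apply/nbhs_ballP; exists (Num.min d1 (Num.min d2 d3)); first by rewrite /= !lt_min d10 d20.
move=> h; rewrite /ball/= sub0r normrN /metric_quotient !lt_min => /and3P[h1 h2 h3].
rewrite neq_lt distrC => /orP[hneg|hpos].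
  rewrite ltr0_norm// in h1 h2 h3 *.
  have := hd2 (- h) ltac:(lra); have := hd3 (- h) ltac:(lra); rewrite opprK.
  rewrite -ler_pdivlMr ?oppr_gt0// => lo; rewrite -ler_pdivrMr ?oppr_gt0// => up.
  by rewrite ler_norml; lra.
rewrite gtr0_norm// in h1 h2 h3 *.
by apply: hd1; rewrite hpos.
Qed.

(** * The descending slope along the curve *)

Lemma descending_slope_le r p : I r -> 0 <= p -> speed_le r p ->
  (descending_slope f (y r) <= p%:E)%E.
Proof.
move=> Ir p0 rp; rewrite /descending_slope ge_max lee_fin p0/=.
apply/lee_addgt0Pr => eps eps0; rewrite -EFinD.
have n0 : 0 < - N by rewrite oppr_gt0.
have den0 : 0 < 2 + 2 * p + eps by lra.
(* Chosen so that [(1 + e) * (p + e) <= (1 - e) * (p + eps)]. *)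
pose e := Num.min (2^-1) (eps / (2 + 2 * p + eps)).
have e0 : 0 < e by rewrite lt_min invr_gt0 ltr0n divr_gt0.
have e2 : e <= 2^-1 by rewrite ge_min lexx.
have ee : e * (2 + 2 * p + eps) <= eps by rewrite -ler_pdivlMr// ge_min lexx orbT.
move: (e) e0 e2 ee => {}e e0 e2 ee.
have e01 : 0 < e < 1 by lra.
have [eta eta0 hS] := slope_estimate e01.
have K0 : 0 <= `|K| by exact: normr_ge0.
pose d1 := e / (`|K| + 1); have d10 : 0 < d1 by rewrite divr_gt0//; lra.
(* This radius keeps the bound [B] on [- excess z r] below [e * - N]. *)
pose d2 := e * - N / (2 * (p + 1)).
have d20 : 0 < d2 by rewrite divr_gt0 ?mulr_gt0//; lra.
have m0 : 0 < Num.min eta (Num.min d1 d2) by rewrite !lt_min eta0 d10.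
apply: (@le_trans _ _ (ereal_sup [set (maxe (- (f z - f (y r))) 0 *
    ((mdist z (y r))^-1)%R%:E)%E | z in ball (y r) (Num.min eta (Num.min d1 d2)) `\ y r])).
  apply: ereal_inf_lbound; exists (ball (y r) (Num.min eta (Num.min d1 d2)) `\ y r) => //.
  by apply/nbhs_ballP; exists (Num.min eta (Num.min d1 d2)) => // z bz zy; split => //; exact/eqP.
apply: ge_ereal_sup => _ [z [bz zy] <-].
rewrite ballEmdist/= !lt_min in bz; case/and3P: bz.
rewrite /d1 /d2 (metric_sym z); set d := mdist (y r) z => deta.
rewrite ltr_pdivlMr; last by lra.
move=> hd1; rewrite ltr_pdivlMr; last by lra.
move=> hd2.
have dgt0 : 0 < d by rewrite /d mdist_gt0; apply/eqP => yz; apply: zy.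
have pe0 : 0 <= p + eps by lra.
have Kd : `|K| * d <= e by have : 0 < d := dgt0; lra.
pose B := (1 + e) * (p * d + `|K| * d ^+ 2).
have hB : B <= (1 + e) * (p + e) * d.
  rewrite -mulrA ler_wpM2l//; first lra.
  have : `|K| * d * d <= e * d by rewrite ler_wpM2r// ltW.
  by rewrite expr2; lra.
have hBn : B <= e * - N.
  apply: (le_trans hB); apply: (@le_trans _ _ (2 * (p + 1) * d)).
    rewrite ler_pM2r// ler_pM//; lra.
  by lra.
have hBd : B <= (1 - e) * ((p + eps) * d).
  apply: (le_trans hB); rewrite mulrA ler_pM2r//.
  have : e * e <= e by rewrite ler_piMr//; lra.
  by lra.
clear ee e2 K0 d10 d20 m0 den0 hd1 hd2 Kd hB.
rewrite lee_pdivrMr//.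
have := fy_fin Ir; have := hS r p z Ir p0 rp.
case fz : (f z) => [c| |] => /(_ _ deta) hz ->.
- have {}hz := hz ltac:(by rewrite /fdom_star/= fz ltry).
  rewrite -EFinB -EFinN -EFin_max -EFinM lee_fin.
  rewrite ge_max mulr_ge0 ?(ltW dgt0)// andbT opprB.
  have [//|cg] := leP (g r - c) 0; first by move/le_trans; apply; rewrite mulr_ge0// ltW.
  have Fz : F z = expR (c / - N) by rewrite /fexpN fz/= invrN mulrC.
  (* Here [- excess z r] is [- N * (1 - expR (- u))]; being at most [e * - N] it forces
     [expR (- u) >= 1 - e], and therefore it is at least [(1 - e) * (g r - c)]. *)
  pose u := (g r - c) / - N.
  have u0 : 0 < u by rewrite divr_gt0.
  have FzF : F z / F (y r) = expR (- u).
    rewrite Fz fexpN_curve// -expRN -expRD; congr expR.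
    by rewrite /u; field; rewrite lt_eqF.
  move: hz; rewrite /excess -/d -/B FzF => hz; have hz' : - N * (1 - expR (- u)) <= B by lra.
  have h1 : 1 + u <= expR u by exact: expR_ge1Dx.
  have h2 : u <= expR u * (1 - expR (- u)).
    by rewrite mulrBr mulr1 -expRD subrr expR0; lra.
  have h3 : 1 - expR (- u) <= e by rewrite -(ler_pM2l n0); lra.
  have h4 : 1 - e <= expR (- u) by lra.
  have h5 : (1 - e) * u <= 1 - expR (- u).
    apply: (@le_trans _ _ (expR (- u) * u)); first by rewrite ler_pM2r.
    apply: (@le_trans _ _ (expR (- u) * (expR u * (1 - expR (- u))))).
      by rewrite ler_pM2l ?expR_gt0.
    by rewrite mulrA -expRD addrC subrr expR0 mul1r.
  have h6 : (1 - e) * (g r - c) <= B.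
    apply: le_trans hz'; have -> : (1 - e) * (g r - c) = - N * ((1 - e) * u).
      by rewrite /u; field; rewrite lt_eqF.
    by rewrite ler_pM2l.
  have e1 : 0 < 1 - e by lra.
  by rewrite -(ler_pM2l e1) (le_trans h6).
- rewrite /= maxNye ?leNye//.
  by rewrite lee_fin mulr_ge0// ltW.
(* If [f z = -oo] then [F z = 0] and [- excess z r] is all of [- N], above its bound [e * - N]: no
   such point lies near [y r]. *)
- exfalso; have {}hz := hz ltac:(by rewrite /fdom_star/= fz).
  have Fz : F z = 0 by rewrite /fexpN fz/= gt0_muleNy// lte_fin oppr_gt0 invr_lt0.
  move: hz; rewrite /excess -/d -/B Fz mul0r sub0r mulrN1 opprK.
  have : e * - N < - N by rewrite gtr_pMl//; lra.
  by lra.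
Qed.

(* The points [y (r + h)] realize the slope: there the energy drops by about
   [p ^+ 2 * h] over the distance [p * h]. *)
Lemma descending_slope_ge r p : I r -> 0 <= p -> speed r p ->
  (p%:E <= descending_slope f (y r))%E.
Proof.
move=> Ir p0 rp; rewrite /descending_slope le_max lee_fin.
move: p0; rewrite le_eqVlt => /predU1P[<-|pgt0]; first by rewrite lexx.
apply/orP; right; apply: le_ereal_inf_tmp => _ [V VF <-].
apply/lee_subgt0Pr => eps eps0; rewrite -EFinB.
have p0 : 0 <= p by exact: ltW.
pose e := Num.min (2^-1) (eps / (2 * p)).
have e0 : 0 < e by rewrite lt_min invr_gt0 ltr0n divr_gt0// mulr_gt0.
have e2 : e <= 2^-1 by rewrite ge_min lexx.
have ee : e * (2 * p) <= eps.
  by rewrite -ler_pdivlMr ?mulr_gt0// ge_min lexx orbT.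
move: (e) e0 e2 ee => {}e e0 e2 ee.
have [b /= b0 hV] := (nbhs_ballP _ _).1 VF.
have [d1 d10 hd1] := growth_sharp Ir p0 rp.1 e0.
have e01 : 0 < e < 1 by lra.
have [d2 d20 hd2] := energy_drop_ge Ir p0 rp e01.
(* A speed of at least [p / 2] ensures that [y (r + h)] differs from [y r], as the punctured
   neighbourhood demands. *)
have [d3 d30 hd3] := rp.2 (p / 2) ltac:(lra).
have [d4 d40 hd4] := continuous_mdist (cy Ir) b0.
pose h := Num.min (Num.min d1 d2) (Num.min d3 d4) / 2.
have h0 : 0 < h by rewrite divr_gt0// !lt_min d10 d20 d30.
have hm : h < Num.min (Num.min d1 d2) (Num.min d3 d4).
  by rewrite /h; move: h0; rewrite /h; lra.
move: hm; rewrite !lt_min => /andP[/andP[h1 h2] /andP[h3 h4]].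
have [|Irh up _] := hd1 h; first by rewrite h0.
have drop := hd2 h ltac:(by rewrite h0).
have := hd3 h ltac:(by rewrite h0).
have := hd4 (r + h) ltac:(by rewrite addrAC subrr add0r gtr0_norm).
set d := D (r + h) r in up *; move=> hb lo.
have d0 : 0 < d by apply: lt_le_trans lo; rewrite mulr_gt0//; lra.
apply: (@le_trans _ _ (maxe (- (f (y (r + h)) - f (y r))) 0 *
    (d^-1)%R%:E)%E); last first.
  apply: ereal_sup_ubound; exists (y (r + h)) => //; apply: hV; first by rewrite ballEmdist/= metric_sym.
  by apply/eqP => yrh; move: d0; rewrite /d yrh mdistxx ltxx.
rewrite (fy_fin Ir) (fy_fin Irh) -EFinB -EFinN -EFin_max -EFinM lee_fin opprB.
rewrite ler_pdivlMr// le_max; apply/orP; left.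
apply: le_trans drop; apply: (@le_trans _ _ (p * (1 - 2 * e) * d)).
  by rewrite ler_pM2r//; lra.
have pe0 : 0 <= p * (1 - 2 * e) by rewrite mulr_ge0//; lra.
apply: (le_trans (ler_wpM2l pe0 up)).
have : 0 <= p ^+ 2 * h * (e ^+ 2).
  by apply: mulr_ge0; [apply: mulr_ge0; [exact: sqr_ge0|exact: ltW]|exact: sqr_ge0].
by lra.
Qed.

Lemma dissipation_curve r p : I r -> 0 <= p -> speed r p ->
  derivable ((fun t => g t) : R^o -> R^o) r 1 ->
  derive1 ((fun t => g t) : R^o -> R^o) r = - p ^+ 2 ->
  dissipation f y r = (p ^+ 2)%:E.
Proof.
move=> Ir p0 rp dg g'p; have [_ mdE] := metric_derivative_curve Ir p0 rp dg g'p.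
have -> : dissipation f y r = ((2^-1 * p ^+ 2)%R%:E + (2^-1)%R%:E * p%:E ^+ 2)%E.
  rewrite /dissipation mdE; congr (_ + _ * _ ^+ 2)%E.
  apply/eqP; rewrite eq_le descending_slope_ge// andbT.
  by apply: descending_slope_le => //; exact: rp.1.
by rewrite -EFin_expe -EFinM -EFinD; congr EFin; field.
Qed.

(** * Absolute continuity and the energy dissipation equality *)

Lemma ae_dissipation : {ae mu, forall r, I r ->
  [/\ metric_derivable y r, derivable ((fun t => g t) : R^o -> R^o) r 1,
      derive1 ((fun t => g t) : R^o -> R^o) r = - max_speed r ^+ 2
    & dissipation f y r = (max_speed r ^+ 2)%:E]}.
Proof.
have aeF := ae_filter_ringOfSetsType mu.
have good : {ae mu, forall r, I r -> exists2 p, 0 <= p & speed r p}.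
  apply: ae_timespan => a b Ia Ib ab; apply: filterS (ae_speed Ia Ib ab) => r hr rab.
  by apply: hr; lra.
apply: filterS2 good ae_derivable_energy => r hp hd Ir.
have [p p0 rp] := hp Ir; have [dg g'] := hd Ir.
rewrite (max_speedE Ir p0 rp) in g' *.
have [md _] := metric_derivative_curve Ir p0 rp dg g'.
by split => //; exact: dissipation_curve.
Qed.

Lemma timespan_compact A : compact A -> A `<=` I -> A !=set0 ->
  exists a b, [/\ I a, I b & A `<=` `[a, b]].
Proof.
move=> cA AI A0; have idA : {within A, continuous (fun x : R => x)}.
  by apply: continuous_subspaceT => x; exact: cvg_id.
have [a /set_mem Aa amin] := compact_EVT_min A0 cA idA.
have [b /set_mem Ab bmax] := compact_EVT_max A0 cA idA.
exists a, b; split; [exact: AI|exact: AI|move=> r Ar /=].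
by rewrite in_itv/= amin ?bmax// inE.
Qed.

Lemma Lp_loc_ge0 p (m h : R -> R) : measurable_fun [set: R] m ->
  measurable_fun [set: R] h -> (forall r, `|m r| `^ p = h r) ->
  (forall s t, I s -> I t -> mu.-integrable `[s, t] (EFin \o h)) ->
  Lp_loc p T m.
Proof.
move=> mm mh mhE ih; have h0 r : 0 <= h r by rewrite -mhE powR_ge0.
split; first exact: measurable_funTS.
have -> : (fun t => `|m t| `^ p) = h by apply/funext.
split; [exact: measurable_funTS|exact: open_timespan|move=> A AI cA].
have [A0|/set0P A0] := eqVneq A set0; first by rewrite A0 integral_set0.
have [a [b [Ia Ib Aab]]] := timespan_compact cA AI A0.
have /integrableP[_] := ih a b Ia Ib; apply: le_lt_trans.
apply: ge0_subset_integral => //; first exact: compact_measurable.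
by apply/measurable_EFinP/measurableT_comp => //; exact: measurable_funTS.
Qed.

Lemma Lp_loc_max_speed : Lp_loc 1 T max_speed.
Proof.
apply: (@Lp_loc_ge0 _ _ max_speed); [exact: measurable_max_speed..| |].
  by move=> r; rewrite powRr1// ger0_norm// max_speed_ge0.
exact: integrable_max_speed.
Qed.

Let measurable_max_speed_sqr :
  measurable_fun [set: R] (fun r => max_speed r ^+ 2).
Proof. by apply: measurable_funX; exact: measurable_max_speed. Qed.

Lemma Lp_loc2_max_speed : Lp_loc 2 T max_speed.
Proof.
apply: (@Lp_loc_ge0 _ _ (fun r => max_speed r ^+ 2)) => //.
- exact: measurable_max_speed.
- by move=> r; rewrite powR_mulrn// ger0_norm// max_speed_ge0.
- exact: integrable_max_speed_sqr.
Qed.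

Lemma Lp_loc_max_speed_sqr : Lp_loc 1 T (fun r => max_speed r ^+ 2).
Proof.
apply: (@Lp_loc_ge0 _ _ (fun r => max_speed r ^+ 2)) => //.
  by move=> r; rewrite powRr1// ger0_norm// sqr_ge0.
exact: integrable_max_speed_sqr.
Qed.

Lemma AC_loc_curve p : Lp_loc p T max_speed -> AC_loc p T y.
Proof.
move=> Lp; exists max_speed => // s t Is It st.
rewrite metric_sym; apply: le_trans (_ : (\int[mu]_(r in `[s, t]) max_speed r)%:E <= _)%E.
  by rewrite lee_fin; apply: dist_le_integral => //; exact: ltW.
by rewrite /Rintegral fineK//; apply: integrable_fin_num => //; exact: integrable_max_speed.
Qed.

Lemma energy_integralE s t : I s -> I t -> s <= t ->
  (\int[mu]_(r in `[s, t]) (max_speed r ^+ 2)%:E)%E = (g s - g t)%:E.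
Proof.
move=> Is It st; rewrite -energy_integral// /Rintegral fineK//.
by apply: integrable_fin_num => //; exact: integrable_max_speed_sqr.
Qed.

Lemma maximal_slope_curve_EVI : maximal_slope_curve f T y.
Proof.
split.
- by case: y_EVI.
- exact/AC_loc_curve/Lp_loc_max_speed.
- exists (fun r => max_speed r ^+ 2); first exact: Lp_loc_max_speed_sqr.
  move=> s t Is It st; rewrite energy_integralE ?(ltW st)// lee_fin.
  have := energy_nonincreasing Is It (ltW st).
  rewrite (_ : mdist _ _ = `|g t - g s|) => [?|//].
  by rewrite distrC ger0_norm// subr_ge0.
- have aeF := ae_filter_ringOfSetsType mu.
  apply: filterS ae_dissipation => r /[swap] Ir /(_ Ir)[md dg g' ->].
  by split => //; rewrite g' opprK.
Qed.

Let dissipation_ge0 s : (0 <= dissipation f y s)%E.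
Proof.
rewrite /dissipation adde_ge0//; first by rewrite lee_fin mulr_ge0// sqr_ge0.
by rewrite mule_ge0// sqre_ge0.
Qed.

Lemma integral_dissipation s t : 0 <= s -> I t ->
  (\int[mu]_(r in `]s, t[) dissipation f y r
   = \int[mu]_(r in `]s, t]) (max_speed r ^+ 2)%:E)%E.
Proof.
move=> s0 It; have aeF := ae_filter_ringOfSetsType mu.
have m2 (A : set R) : measurable_fun A (fun r => (max_speed r ^+ 2)%:E).
  by apply/measurable_EFinP; exact: measurable_funTS.
rewrite -integral_itv_bndo_bndc//; apply: ge0_ae_eq_integral_nonmeasurable => //.
  by move=> r; rewrite lee_fin sqr_ge0.
apply: filterS ae_dissipation => r hr /=; rewrite in_itv/= => /andP[sr rt].
have /hr[//] : I r.
split; first exact: le_lt_trans sr.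
by apply: lt_trans It.2; rewrite lte_fin.
Qed.

(** Monotone convergence over the growing intervals [[u n, t]]. It takes place in the extended
    reals, so an infinite initial energy is included. *)
Lemma energy_limit (l : \bar R) t : f (y e) @[e --> 0^'+] --> l -> I t ->
  (l = f (y t) + \int[mu]_(r in `]0%R, t]) (max_speed r ^+ 2)%:E)%E.
Proof.
move=> fl It; have [t0 _] := It.
pose u n := t * n.+1%:R^-1.
have u0 n : 0 < u n by rewrite mulr_gt0// invr_gt0.
have ut n : u n <= t by rewrite ger_pMr// invf_le1// ler1n.
have Iu n : I (u n).
  by split => //; apply: le_lt_trans It.2; rewrite lee_fin.
have cu : u n @[n --> \oo] --> (0 : R).
  by rewrite -(mulr0 t); apply: cvgM; [exact: cvg_cst|exact: cvg_harmonic].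
have cfu : f (y (u n)) @[n --> \oo] --> l.
  apply: cvg_comp fl; move=> A /nbhs_ballP[d /= d0 hd].
  have [n _ hn] := ((cvgrPdist_lt _ _).1 cu) d d0; exists n => // k nk; apply: hd => //=.
  exact: hn.
have ci : (\int[mu]_(r in `[u n, t]) (max_speed r ^+ 2)%:E)%E @[n --> \oo] -->
    (\int[mu]_(r in `]0%R, t]) (max_speed r ^+ 2)%:E)%E.
  rewrite (_ : `]0, t]%classic = \bigcup_n `[u n, t]%classic); last first.
    apply/seteqP; split => r /=; last first.
      by move=> [n _] /=; rewrite !in_itv/= => /andP[ur ->]; rewrite (lt_le_trans _ ur).
    rewrite in_itv/= => /andP[r0 rt].
    have [n _ hn] := ((cvgrPdist_lt _ _).1 cu) r r0; exists n => //=.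
    rewrite in_itv/= rt andbT; have := hn n (leqnn n).
    by rewrite /= sub0r normrN gtr0_norm// => /ltW.
  apply: ge0_nondecreasing_set_cvg_integral => //.
  - move=> n m nm; apply/subsetPset => r /=; rewrite !in_itv/= => /andP[ur ->].
    rewrite andbT; apply: le_trans ur.
    by rewrite ler_pM2l// lef_pV2 ?posrE// ler_nat.
  - by move=> n; apply/measurable_EFinP; exact: measurable_funTS.
  - by move=> *; rewrite lee_fin sqr_ge0.
have uE n : f (y (u n)) =
    (f (y t) + \int[mu]_(r in `[u n, t]) (max_speed r ^+ 2)%:E)%E.
  rewrite energy_integralE// (fy_fin (Iu n)) (fy_fin It) -EFinD.
  by rewrite addrC subrK.
have c2 : f (y (u n)) @[n --> \oo] -->
    (f (y t) + \int[mu]_(r in `]0%R, t]) (max_speed r ^+ 2)%:E)%E.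
  rewrite (_ : (fun n => f (y (u n))) = fun n =>
    (f (y t) + \int[mu]_(r in `[u n, t]) (max_speed r ^+ 2)%:E)%E); last exact/funext.
  apply: cvgeD => //; last exact: cvg_cst.
  by rewrite (fy_fin It) fin_num_adde_defr.
exact: (cvg_unique (@ereal_hausdorff R) cfu c2).
Qed.

Lemma energy_right_limit b : I b ->
  exists l : \bar R, f (y e) @[e --> 0^'+] --> l.
Proof.
move=> Ib; exists (ereal_sup [set f (y x) | x in `]0, b[%classic]).
apply: nonincreasing_at_right_cvge => [|s t].
  by rewrite bnd_simp; case: Ib.
have II r : r \in `]0, b[%R -> I r.
  rewrite in_itv/= => /andP[r0 rb]; split => //.
  by apply: lt_trans Ib.2; rewrite lte_fin.
move=> /II Is /II It st; rewrite (fy_fin Is) (fy_fin It) lee_fin.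
exact: energy_nonincreasing.
Qed.

Lemma EDE_increment e t : I e -> I t -> e < t ->
  (f (y e) - f (y t) = \int[mu]_(s in `]e, t[) dissipation f y s)%E.
Proof.
move=> Ie It et; rewrite integral_dissipation//; last by case: Ie => /ltW.
rewrite integral_itv_obnd_cbnd; last first.
  by apply/measurable_EFinP; exact: measurable_funTS.
by rewrite energy_integralE ?(ltW et)// (fy_fin Ie) (fy_fin It).
Qed.

Lemma EDE_limit (l : \bar R) t : f (y e) @[e --> 0^'+] --> l -> l != +oo%E ->
  I t -> (f (y t) = l - \int[mu]_(s in `]0%R, t[) dissipation f y s)%E.
Proof.
move=> fl loo It; rewrite integral_dissipation//.
have := energy_limit fl It; set J := (integral _ _ _) => lE.
have J0 : (0 <= J)%E by apply: integral_ge0 => r _; rewrite lee_fin sqr_ge0.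
(* Since [l] is not [+oo], the integral is finite and may be cancelled. *)
rewrite lE addeK//; move: loo; rewrite lE (fy_fin It) ge0_fin_numE// ltey.
by apply: contra => /eqP ->.
Qed.

Lemma EDE_EVI b : I b -> EDE f T y.
Proof.
move=> Ib; have [l fl] := energy_right_limit Ib.
exists l => //; case: ifPn => [_ e t|loo t]; first exact: EDE_increment.
exact: EDE_limit.
Qed.

Lemma EDI_EVI b : I b -> EDI f T y.
Proof.
move=> Ib; split; first exact/AC_loc_curve/Lp_loc2_max_speed.
have [l fl] := energy_right_limit Ib.
exists l => //; case: ifPn => [_ e t Ie It et|loo t It].
  by rewrite EDE_increment.
by rewrite -EDE_limit.
Qed.

End evi_curve.

Theorem proposition5p4 (R : realType) (X : metricType R)
    (X_intrinsic : strictly_intrinsic X)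
    (X_completion : has_geodesic_completion X)
    (f : X -> \bar R)
    (f_dense : densely_defined f)
    (f_lsc : lower_semicontinuous f)
    (K N : R) (N_lt0 : N < 0)
    (T : \bar R) (T_gt0 : (0 < T)%E)
    (y : R -> X)
    (y_EVI : EVI_gradient_curve K N f T y) :
  [/\ maximal_slope_curve f T y, EDE f T y & EDI f T y].
Proof.
have [b Ib] : timespan T !=set0.
  case: T T_gt0 {y_EVI} => [T| |]//.
    by rewrite lte_fin => T0; exists (T / 2); split; rewrite ?lte_fin; lra.
  by move=> _; exists 1; split => //; rewrite ltry.
split; first exact: (maximal_slope_curve_EVI N_lt0 f_lsc y_EVI).
  exact: (EDE_EVI N_lt0 f_lsc y_EVI Ib).
exact: (EDI_EVI N_lt0 f_lsc y_EVI Ib).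
Qed.
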